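(* Let $a(\theta)>0$, $a'(\theta)\ge 0$ and $\frac12\left(\frac{Z(\theta)}{\theta}\right)'\ge 0$ hold for all $\theta>0$. Consider initial data $(\rho_0,u_0,\theta_0,q_0,S_0)$ such that, for some $s\ge 2$, $(\rho_0-1,u_0,\theta_0-1,q_0,S_0)\in H^s(\mathbb R)$, $\min_x(\rho_0(x),\theta_0(x))>0$, the functions $\rho_0-1,\,u_0,\,\theta_0-1,\,q_0,\,S_0$ are compactly supported in $(-M,M)$ for some $M>0$, and $$G(0)>0 .$$ Then, provided that the compact support of the initial data is sufficiently large (i.e. $M$ is sufficiently large) and $\gamma:=1+\frac{R}{C_v}$ is sufficiently close to $1$, there exists such initial data $(\rho_0,u_0,\theta_0,q_0,S_0)$ satisfying $$F(0)>\frac{32\,\sigma \max\rho_0}{3-\gamma}\,M^2$$ and $$4\left(\frac{(3-\gamma)\mu\tau_2}{M^2}+\gamma-1\right)\left(H_0+\frac{\max\rho_0}{2}\|u_0\|_{L^2}^2\right)\le \frac{128\,\sigma^2\max\rho_0\, M}{3-\gamma},$$ such that the length $T_0$ of the maximal interval of existence of a smooth solution $(\rho,u,\theta,q,S)$ of the Cauchy problem (system (NS) with initial data $(\rho_0,u_0,\theta_0,q_0,S_0)$) is finite.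
   Context: The system (NS) for unknowns $(\rho,u,\theta,q,S)(t,x)$, with $\rho>0$, $\theta>0$, $(t,x)\in[0,\infty)\times\mathbb R$, is $$\rho_t+(\rho u)_x=0,\qquad \rho u_t+\rho u u_x+p_x=S_x,\qquad E_t+(uE+pu+q-Su)_x=0,$$ $$\tau_1(\theta)(\rho q_t+\rho u\, q_x)+q+\kappa(\theta)\theta_x=0,\qquad \tau_2(\rho S_t+\rho u\, S_x)+S=\mu u_x,$$ with $$E=\tfrac12\rho u^2+\tfrac{\tau_2}{2\mu}\rho S^2+\rho e,\quad e=C_v\theta+a(\theta)q^2,\quad p=R\rho\theta,\quad a(\theta)=\frac{Z(\theta)}{\theta}-\frac12 Z'(\theta),\quad Z(\theta)=\frac{\tau_1(\theta)}{\kappa(\theta)}.$$ Here $\tau_2,\mu,C_v,R>0$ are constants and $\tau_1(\theta),\kappa(\theta)>0$ are (smooth) functions of $\theta>0$. The initial condition is $(\rho,u,\theta,q,S)(0,x)=(\rho_0,u_0,\theta_0,q_0,S_0)(x)$. Smooth solutions on a time interval are understood in the class $(\rho-1,u,\theta-1,q,S)\in C^0(H^s(\mathbb R))\cap C^1(H^{s-1}(\mathbb R))$ (in time) with $\rho,\theta>0$. $\sigma$ is the constant of finite propagation speed: if the data $(\rho_0-1,u_0,\theta_0-1,q_0,S_0)$ are supported in $(-M,M)$, then the solution on $[0,T_0)$ satisfies $(\rho,u,\theta,q,S)(t,x)=(1,0,1,0,0)$ for all $|x|\ge M+\sigma t$, $0\le t<T_0$. The averaged quantities are $$F(t):=\int_{\mathbb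 R}\rho u\, x\,dx-\tau_2\int_{\mathbb R}\rho S\,dx,\qquad G(t):=\int_{\mathbb R}(E(t,x)-\bar E)\,dx,\qquad \bar E:=C_v,$$ so $F(0),G(0)$ are given by the initial data, and $$H_0:=\int_{\mathbb R}\Big[C_v\rho_0(\theta_0-\ln\theta_0-1)+R(\rho_0\ln\rho_0-\rho_0+1)+\rho_0\Big(a(\theta_0)+\tfrac12\Big(\tfrac{Z}{\theta}\Big)'(\theta_0)\Big)q_0^2+\tfrac{\tau_2}{2\mu}S_0^2\Big]dx .$$ *)

(* Defs.v *)
From HB Require Import structures.
From mathcomp Require Import all_boot all_order all_algebra.
From mathcomp Require Import all_classical all_reals all_analysis.

Set Implicit Arguments.
Unset Strict Implicit.
Unset Printing Implicit Defensive.

Import Order.TTheory GRing.Theory Num.Theory.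
Import numFieldNormedType.Exports.

Local Open Scope ring_scope.
Local Open Scope classical_set_scope.

Definition tsupport (R : realType) (f : R -> R) : set R :=
  closure [set x | f x != 0].

Definition test_function (R : realType) (phi : R -> R) : Prop :=
  (forall (n : nat) (x : R), derivable (derive1n n phi) x 1) /\ compact (tsupport phi).

Definition is_weak_derivative (R : realType) (k : nat) (f g : R -> R) : Prop :=
  [/\ locally_integrable [set: R] f, locally_integrable [set: R] g &
      forall phi : R -> R, test_function phi ->
        \int[lebesgue_measure]_(x in [set: R]) (f x * derive1n k phi x) =
        (-1) ^+ k * \int[lebesgue_measure]_(x in [set: R]) (g x * phi x)].

(* Only determined almost everywhere, and only meaningful when a weak
   derivative exists; below it occurs only inside L^2 norms of functions of
   H^s. *)
Definition weak_derivative (R : realType) (k : nat) (f : R -> R) : R -> R :=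
  get (is_weak_derivative k f).

Definition L2norm (R : realType) (f : R -> R) : \bar R :=
  Lnorm lebesgue_measure 2%:E (EFin \o f).

Definition in_Hs (R : realType) (s : nat) (f : R -> R) : Prop :=
  forall k : nat, (k <= s)%N ->
    exists g : R -> R, is_weak_derivative k f g /\ (L2norm g < +oo)%E.

Definition Hs_norm (R : realType) (s : nat) (f : R -> R) : \bar R :=
  (\sum_(k < s.+1) L2norm (weak_derivative k f))%E.

(* For s >= 1 every class in H^s(R) has a unique continuous representative;
   suprema, supports and classical derivatives always refer to that one. *)
Definition cont_Hs (R : realType) (s : nat) (f : R -> R) : Prop :=
  continuous f /\ in_Hs s f.

(* A function of (t,x) is curried with time first: f t is the slice f(t, .).
   The time interval is [0,T), so limits at t0 = 0 are one-sided. *)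
Definition C0_Hs (R : realType) (s : nat) (T : R) (f : R -> R -> R) : Prop :=
  (forall t : R, 0 <= t < T -> cont_Hs s (f t)) /\
  (forall t0 : R, 0 <= t0 < T ->
     Hs_norm s (fun x => f t x - f t0 x)
       @[t --> within [set t | 0 <= t < T] (nbhs t0)] --> 0%E).

Definition C1_Hs (R : realType) (s : nat) (T : R) (f : R -> R -> R) : Prop :=
  C0_Hs s T f /\
  exists df : R -> R -> R, C0_Hs s T df /\
    forall t0 : R, 0 <= t0 < T ->
      Hs_norm s (fun x => (f t x - f t0 x) / (t - t0) - df t0 x)
        @[t --> within [set t | 0 <= t < T] t0^'] --> 0%E.

Record gas (R : realType) := Gas {
  tau2 : R;
  mu : R;
  Cv : R;
  Rgas : R;
  tau1 : R -> R;
  kappa : R -> R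
}.

Definition smooth_on_pos (R : realType) (f : R -> R) : Prop :=
  forall (n : nat) (th : R), 0 < th -> derivable (derive1n n f) th 1.

Definition Zfun (R : realType) (tau1 kappa : R -> R) (th : R) : R :=
  tau1 th / kappa th.

Definition afun (R : realType) (tau1 kappa : R -> R) (th : R) : R :=
  Zfun tau1 kappa th / th - 2^-1 * derive1 (Zfun tau1 kappa) th.

Definition half_dZ_over (R : realType) (tau1 kappa : R -> R) (th : R) : R :=
  2^-1 * derive1 (fun y : R => Zfun tau1 kappa y / y) th.

(* (rho, u, theta, q, S) at a fixed time *)
Record state (R : realType) := State {
  density : R -> R;
  velocity : R -> R;
  temperature : R -> R;
  heatflux : R -> R;
  stress : R -> R
}.

Section System.
Context {R : realType}.
Implicit Types (P : gas R) (W : state R) (U : R -> state R).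

Definition gamma P : R := 1 + Rgas P / Cv P.

Definition pressure P W (x : R) : R := Rgas P * density W x * temperature W x.

Definition energy P W (x : R) : R :=
  2^-1 * density W x * velocity W x ^+ 2
  + tau2 P / (2 * mu P) * density W x * stress W x ^+ 2
  + density W x * (Cv P * temperature W x
      + afun (tau1 P) (kappa P) (temperature W x) * heatflux W x ^+ 2).

Definition satisfies_NS P (T : R) U : Prop :=
  forall t x : R, 0 < t < T ->
  let rho := fun t x => density (U t) x in
  let u := fun t x => velocity (U t) x in
  let theta := fun t x => temperature (U t) x in
  let q := fun t x => heatflux (U t) x in
  let S := fun t x => stress (U t) x in
  let p := fun t x => pressure P (U t) x in
  let E := fun t x => energy P (U t) x in
  let dt := fun f : R -> R -> R => derive1 (fun t' => f t' x) t in
  let dx := fun f : R -> R -> R => derive1 (f t) x in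
  [/\ dt rho + dx (fun t x => rho t x * u t x) = 0,
      rho t x * dt u + rho t x * u t x * dx u + dx p = dx S,
      dt E + dx (fun t x => u t x * E t x + p t x * u t x + q t x
                            - S t x * u t x) = 0,
      tau1 P (theta t x) * (rho t x * dt q + rho t x * u t x * dx q)
        + q t x + kappa P (theta t x) * dx theta = 0 &
      tau2 P * (rho t x * dt S + rho t x * u t x * dx S) + S t x
        = mu P * dx u].

(* For s >= 2, H^(s-1) embeds in the bounded continuous functions; hence all
   components are C^1 in (t,x) and derive1 in satisfies_NS is the classical
   partial derivative. At t = 0 the equations follow by continuity. *)
Definition smooth_solution P (s : nat) (T : R) (U0 : state R) U : Prop :=
  let cls := fun f : R -> R -> R => C0_Hs s T f /\ C1_Hs s.-1 T f in
  [/\ U 0 = U0,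
      [/\ cls (fun t x => density (U t) x - 1),
          cls (fun t => velocity (U t)),
          cls (fun t x => temperature (U t) x - 1),
          cls (fun t => heatflux (U t)) &
          cls (fun t => stress (U t))],
      forall t x : R, 0 <= t < T ->
        0 < density (U t) x /\ 0 < temperature (U t) x &
      satisfies_NS P T U].

(* The length of the maximal interval [0,T0) on which a smooth solution
   exists. T = 0 (empty interval) is admitted, so lifespan is always >= 0. *)
Definition lifespan P (s : nat) (U0 : state R) : \bar R :=
  ereal_sup [set T%:E | T in [set T : R | 0 <= T /\
    exists U : R -> state R, smooth_solution P s T U0 U]].

Definition Hs_data (s : nat) W : Prop :=
  [/\ cont_Hs s (fun x => density W x - 1), cont_Hs s (velocity W),
      cont_Hs s (fun x => temperature W x - 1), cont_Hs s (heatflux W) &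
      cont_Hs s (stress W)].

Definition positive_data W : Prop :=
  0 < inf (range (fun x => Num.min (density W x) (temperature W x))).

Definition supported_in (M : R) W : Prop :=
  let inside := fun f : R -> R => tsupport f `<=` [set x | - M < x < M] in
  [/\ inside (fun x => density W x - 1), inside (velocity W),
      inside (fun x => temperature W x - 1), inside (heatflux W) &
      inside (stress W)].

Definition finite_propagation_speed P (s : nat) (sigma : R) : Prop :=
  forall (U0 : state R) (M T : R) (U : R -> state R),
    Hs_data s U0 -> positive_data U0 -> 0 < M -> supported_in M U0 ->
    0 < T -> smooth_solution P s T U0 U ->
    forall t x : R, 0 <= t < T -> M + sigma * t <= `|x| ->
      [/\ density (U t) x = 1, velocity (U t) x = 0,
          temperature (U t) x = 1, heatflux (U t) x = 0 &
          stress (U t) x = 0].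

Definition Ffun P W : R :=
  \int[lebesgue_measure]_(x in [set: R]) (density W x * velocity W x * x)
  - tau2 P *
    \int[lebesgue_measure]_(x in [set: R]) (density W x * stress W x).

Definition Gfun P W : R :=
  \int[lebesgue_measure]_(x in [set: R]) (energy P W x - Cv P).

(* The last term is S^2 without the factor rho. *)
Definition Hfun P W : R :=
  \int[lebesgue_measure]_(x in [set: R])
    (Cv P * density W x * (temperature W x - ln (temperature W x) - 1)
     + Rgas P * (density W x * ln (density W x) - density W x + 1)
     + density W x
       * (afun (tau1 P) (kappa P) (temperature W x)
          + half_dZ_over (tau1 P) (kappa P) (temperature W x))
       * heatflux W x ^+ 2
     + tau2 P / (2 * mu P) * stress W x ^+ 2).

Definition max_density W : R := sup (range (density W)).

End System.

(* Main.v *)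
(* Take rho_0 = theta_0 = 1, q_0 = S_0 = 0 and u_0(x) = A sigma w(x / M) with a
   bump w.  Mass and energy conservation together with the entropy inequality
   give int rho theta >= int 1, so the pressure only helps: F' >= int rho u^2,
   and tau2 / (2 mu) int rho S^2 <= G(0).  Up to time M / sigma the perturbation
   lives in [-2M, 2M], where the mass is 4M, so the Cauchy-Schwarz inequality
   yields F' >= F^2 / (64 M^3) as soon as M is large enough for the term
   tau2 int rho S to be at most F(0) / 2.  With F(0) >= 64 sigma M^2 this Riccati
   inequality forbids existence beyond M / sigma.

   The integral identities need classical derivatives, whereas solutions are only
   given in Sobolev classes.  A continuous function with two locally integrable
   weak derivatives is C^1 (test against smoothed indicator functions at Lebesgue
   points), and the sup norm is bounded by L^2 norms over unit intervals, so that
   convergence in H^s gives uniform convergence. *)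

Require Import Defs.
From mathcomp Require Import all_boot all_order all_algebra.
From mathcomp Require Import all_classical all_reals all_analysis.
From mathcomp Require Import measurable_realfun ring lra.

Set Implicit Arguments.
Unset Strict Implicit.
Unset Printing Implicit Defensive.

Import Order.TTheory GRing.Theory Num.Theory.
Import numFieldNormedType.Exports.

Local Open Scope ring_scope.
Local Open Scope classical_set_scope.

(** * Smooth functions *)

Section Calculus.
Context {R : realType}.
Implicit Types (f g F : R -> R) (x y c d : R) (n : nat).

(** The numbers [delta] and [M0] must be fixed before [sigma], [Cv] and [Rgas] are given. Therefore
    the velocity carries the factor [sigma], and [A] depends on the bump alone. The squared L^2 norm
    of the velocity is then of order A^2 sigma^2 M, so its prefactor in the second inequality has to
    be of order A^-2; a large [M] and a [gamma] near 1 achieve this.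

    The quadratic bound on F' is derived only where F >= F(0), since half of F(0) absorbs the stress
    term. There is no circularity: F' >= 0 holds at all times, so F >= F(0) comes first. The bound
    on int rho S^2 rests on the entropy as well, for the energy controls the stress only once the
    thermal energy is known not to fall below its rest value.

    All balances are taken on a segment [-L, L] whose endpoints stay in the rest state. Boundary
    fluxes cancel there, and differentiation under the integral needs bounds on compact sets only.
    Time derivatives are used at interior times, so the initial values enter through continuity up
    to t = 0. *)

Lemma is_derive_add f g x (df dg : R) :
  is_derive x 1 f df -> is_derive x 1 g dg ->
  is_derive x 1 (fun y => f y + g y) (df + dg).
Proof. by move=> ? ?; exact: is_deriveD. Qed.

Lemma is_derive_sub f g x (df dg : R) :
  is_derive x 1 f df -> is_derive x 1 g dg ->
  is_derive x 1 (fun y => f y - g y) (df - dg).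
Proof. by move=> ? ?; exact: is_deriveB. Qed.

Lemma is_derive_opp f x (df : R) :
  is_derive x 1 f df -> is_derive x 1 (fun y => - f y) (- df).
Proof. by move=> ?; exact: is_deriveN. Qed.

Lemma is_derive_mul f g x (df dg : R) :
  is_derive x 1 f df -> is_derive x 1 g dg ->
  is_derive x 1 (fun y => f y * g y) (f x * dg + g x * df).
Proof. by move=> ? ?; exact: is_deriveM. Qed.

Lemma is_derive_scale c f x (df : R) :
  is_derive x 1 f df -> is_derive x 1 (fun y => c * f y) (c * df).
Proof.
move=> fd; apply: is_derive_eq (is_derive_mul (is_derive_cst c x 1) fd) _.
by rewrite mulr0 addr0.
Qed.

Lemma is_derive_exp n f x (df : R) :
  is_derive x 1 f df ->
  is_derive x 1 (fun y => f y ^+ n) (n%:R * f x ^+ n.-1 * df).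
Proof.
move=> fd; rewrite (_ : (fun y => f y ^+ n) = f ^+ n); last first.
  by apply/funext => y; elim: n => [|n IH]; rewrite ?expr0// !exprS IH.
exact: is_deriveX.
Qed.

Lemma is_derive_inv f x (df : R) :
  f x != 0 -> is_derive x 1 f df ->
  is_derive x 1 (fun y => (f y)^-1) (- (f x) ^- 2 * df).
Proof.
move=> f0 [fd fE]; apply: DeriveDef; first exact: derivableV.
by rewrite deriveV// fE.
Qed.

Lemma is_derive_chain f g x (df dg : R) :
  is_derive (f x) 1 g dg -> is_derive x 1 f df ->
  is_derive x 1 (fun y => g (f y)) (dg * df).
Proof.
by move=> ? ?; exact: (@is_derive1_comp R g f x dg df).
Qed.

Lemma is_derive1E f x (df : R) : is_derive x 1 f df -> derive1 f x = df.
Proof. by case=> _ <-; rewrite derive1E. Qed.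

Lemma derivable_is_derive1 f x : derivable f x 1 -> is_derive x 1 f (derive1 f x).
Proof. by move=> fd; apply: DeriveDef => //; rewrite derive1E. Qed.

Lemma is_derive_continuous f x (df : R) : is_derive x 1 f df -> {for x, continuous f}.
Proof. by case=> + _ => /derivable1_diffP/differentiable_continuous. Qed.

(** Differentiates from the inside, while [derive1n] adds derivatives from the outside. The inner
    form lets an induction on [n] generalise over [f], so that the product, inverse and chain rules
    iterate without a Leibniz formula. *)
Fixpoint ck n f : Prop :=
  if n is m.+1 then (forall x, derivable f x 1) /\ ck m (derive1 f) else True.

Definition smooth f := forall n x, derivable (derive1n n f) x 1.

Lemma smoothP f : smooth f <-> forall n, ck n f.
Proof.
split=> [+ n|].
  elim: n f => //= n IH f sf; split; first exact: (sf 0%N).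
  by apply: IH => m x; rewrite -derive1Sn; exact: sf.
move=> + n; elim: n f => [|n IH] f cf x; first by have [] := cf 1%N.
by rewrite derive1Sn; apply: IH => m; have [] := cf m.+1.
Qed.

Lemma ckS n f : ck n.+1 f -> ck n f.
Proof.
elim: n f => //= n IH f [df [d2f cf]]; split => //.
by apply: IH; split.
Qed.

Lemma ckD n f g : ck n f -> ck n g -> ck n (fun x => f x + g x).
Proof.
elim: n f g => //= n IH f g [df cf] [dg cg].
have D x : is_derive x 1 (fun x => f x + g x) (derive1 f x + derive1 g x).
  by apply: is_derive_add; exact: derivable_is_derive1.
split=> [x|]; first by have [] := D x.
rewrite (_ : derive1 _ = fun x => derive1 f x + derive1 g x); first exact: IH.
by apply/funext => x; exact: (is_derive1E (D x)).
Qed.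

Lemma ckM n f g : ck n f -> ck n g -> ck n (fun x => f x * g x).
Proof.
elim: n f g => // n IH f g Cf Cg; have [df cf] := Cf; have [dg cg] := Cg.
have D x : is_derive x 1 (fun x => f x * g x) (f x * derive1 g x + g x * derive1 f x).
  by apply: is_derive_mul; exact: derivable_is_derive1.
split=> [x|]; first by have [] := D x.
rewrite (_ : derive1 _ = fun x => f x * derive1 g x + g x * derive1 f x).
  by apply: ckD; apply: IH => //; exact: ckS.
by apply/funext => x; exact: (is_derive1E (D x)).
Qed.

Lemma ck_cst n c : ck n (fun=> c).
Proof.
elim: n c => //= n IH c; split=> [x|]; first exact: derivable_cst.
rewrite (_ : derive1 _ = fun=> 0) //; apply/funext => x.
exact: derive1_cst.
Qed.

Lemma ckV n f : (forall x, f x != 0) -> ck n f -> ck n (fun x => (f x)^-1).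
Proof.
move=> f0; elim: n => // n IH Cf; have [df cf] := Cf.
have D x : is_derive x 1 (fun x => (f x)^-1) (- (f x) ^- 2 * derive1 f x).
  by apply: is_derive_inv => //; exact: derivable_is_derive1.
split=> [x|]; first by have [] := D x.
rewrite (_ : derive1 _ = fun x => (-1 * ((f x)^-1 * (f x)^-1)) * derive1 f x).
  have If := IH (ckS Cf).
  by apply: ckM => //; apply: ckM; [exact: ck_cst|exact: ckM].
by apply/funext => x; rewrite (is_derive1E (D x)) expr2 invfM mulN1r.
Qed.

Lemma is_derive_affine c d x : is_derive x 1 (fun y => c * y + d) c.
Proof.
have := is_derive_add (is_derive_mul (is_derive_cst c x 1) (is_derive_id x 1))
  (is_derive_cst d x 1).
by rewrite mulr0 !addr0 mulr1.
Qed.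

Lemma ck_affine n f c d : ck n f -> ck n (fun x => f (c * x + d)).
Proof.
elim: n f => // n IH f Cf; have [df cf] := Cf.
have D x : is_derive x 1 (fun x => f (c * x + d)) (derive1 f (c * x + d) * c).
  apply: is_derive_chain; last exact: is_derive_affine.
  exact: derivable_is_derive1.
split=> [x|]; first by have [] := D x.
rewrite (_ : derive1 _ = fun x => derive1 f (c * x + d) * c).
  by apply: ckM; [exact: IH|exact: ck_cst].
by apply/funext => x; exact: (is_derive1E (D x)).
Qed.

Lemma smoothD f g : smooth f -> smooth g -> smooth (fun x => f x + g x).
Proof. by move=> /smoothP sf /smoothP sg; apply/smoothP => n; exact: ckD. Qed.

Lemma smoothM f g : smooth f -> smooth g -> smooth (fun x => f x * g x).
Proof. by move=> /smoothP sf /smoothP sg; apply/smoothP => n; exact: ckM. Qed.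

Lemma smooth_cst c : smooth (fun=> c).
Proof. by apply/smoothP => n; exact: ck_cst. Qed.

Lemma smoothV f : (forall x, f x != 0) -> smooth f -> smooth (fun x => (f x)^-1).
Proof. by move=> f0 /smoothP sf; apply/smoothP => n; exact: ckV. Qed.

Lemma smooth_affine f c d : smooth f -> smooth (fun x => f (c * x + d)).
Proof. by move=> /smoothP sf; apply/smoothP => n; exact: ck_affine. Qed.

Lemma smooth_derive f : smooth f -> smooth (derive1 f).
Proof. by move=> sf n x; rewrite -derive1Sn; exact: sf. Qed.

Lemma smooth_derivable f : smooth f -> forall x, is_derive x 1 f (derive1 f x).
Proof. by move=> sf x; apply: derivable_is_derive1; exact: (sf 0%N). Qed.

Lemma smooth_continuous f : smooth f -> continuous f.
Proof. by move=> sf x; exact: is_derive_continuous (smooth_derivable sf x). Qed.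

End Calculus.

(** * Smooth transition functions built from exp(-1/x) *)

Section SmoothStep.
Context {R : realType}.
Implicit Types (f g : R -> R) (a b x y : R) (n k : nat).

(* This family contains [exp (- 1 / x)] and its span is closed under
   differentiation. *)
Definition flat k x : R := if 0 < x then x^-1 ^+ k * expR (- x^-1) else 0.

Lemma flat_le0 k x : x <= 0 -> flat k x = 0.
Proof. by rewrite /flat ltNge => ->. Qed.

Lemma flat_ge0 k x : 0 <= flat k x.
Proof.
rewrite /flat; case: ifPn => // x0.
by rewrite mulr_ge0 ?expR_ge0// exprn_ge0// invr_ge0 ltW.
Qed.

Lemma flat0_gt0 x : 0 < x -> 0 < flat 0 x.
Proof. by rewrite /flat => ->; rewrite expr0 mul1r expR_gt0. Qed.

(** The term of order [k + 2] of the exponential series at [x^-1] beats [x^-1 ^+ k] by a factor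
    [x ^+ 2]. Quadratic decay is what makes the difference quotient at the origin vanish. *)
Lemma flat_le k x : 0 < x -> flat k x <= k.+2`!%:R * x ^+ 2.
Proof.
move=> x0; rewrite /flat x0 expRN ler_pdivrMr ?expR_gt0//.
have xk : 0 < x ^+ k.+2 by rewrite exprn_gt0.
have fk : 0 < (k.+2`!%:R : R) by rewrite ltr0n fact_gt0.
have := @expR_ge1Dxn _ x^-1 k.+1 (ltW _); rewrite invr_gt0 => /(_ x0) h.
have {h} : x^-1 ^+ k.+2 <= k.+2`!%:R * expR x^-1.
  by rewrite mulrC -ler_pdivrMr// (le_trans _ h)// lerDr.
have -> : k.+2`!%:R * x ^+ 2 * expR x^-1 = x ^+ 2 * (k.+2`!%:R * expR x^-1) by ring.
have -> : x^-1 ^+ k = x ^+ 2 * x^-1 ^+ k.+2 by rewrite !exprS; field; exact: lt0r_neq0.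
by rewrite ler_pM2l// exprn_gt0.
Qed.

Lemma flat_derive k x : is_derive x 1 (flat k) (flat k.+2 x - k%:R * flat k.+1 x).
Proof.
have [x0|x0|->] := ltgtP x 0.
- rewrite !flat_le0 ?ltW// mulr0 subr0.
  apply: (@near_eq_is_derive _ _ _ (cst 0)).
  by near=> y; rewrite flat_le0// ltW//; near: y; exact: lt_nbhsl.
- apply: (@near_eq_is_derive _ _ _ (fun y => y^-1 ^+ k * expR (- y^-1))).
    by near=> y; rewrite /flat ifT//; near: y; exact: lt_nbhsr.
  have dI : is_derive x 1 (fun y : R => y^-1) (- x ^- 2).
    have := @is_derive_inv _ id x 1 (lt0r_neq0 x0) (is_derive_id x 1).
    by rewrite mulr1.
  have dE : is_derive x 1 (fun y => expR (- y^-1)) (expR (- x^-1) * - (- x ^- 2)).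
    exact: (@is_derive_chain _ (fun y => - y^-1) expR _ _ _ (is_derive_expR _)
      (is_derive_opp dI)).
  apply: is_derive_eq (is_derive_mul (is_derive_exp k dI) dE) _.
  rewrite /flat x0 /=.
  case: k => [|k]; rewrite /= !exprS; field; exact: lt0r_neq0.
- have z : flat k.+2 0 - k%:R * flat k.+1 0 = 0 by rewrite !flat_le0// mulr0 subr0.
  rewrite z.
  have c0 : h^-1 *: (flat k (h *: 1 + 0) - flat k 0) @[h --> 0^'] --> (0 : R).
    apply/cvgr0Pnorm_le => e e0.
    have fk : 0 < (k.+2`!%:R : R) by rewrite ltr0n fact_gt0.
    near=> h.
    have h0 : h != 0 by near: h; exact: nbhs_dnbhs_neq.
    have he : `|h| <= e / k.+2`!%:R.
      by near: h; apply: dnbhs0_le; exact: divr_gt0.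
    rewrite [h *: 1]mulr1 addr0 (flat_le0 k (lexx 0)) subr0 normrM normfV.
    rewrite mulrC ler_pdivrMr ?normr_gt0//.
    have [hl|hl] := leP h 0; first by rewrite flat_le0// normr0 mulr_ge0// ltW.
    rewrite ger0_norm ?flat_ge0// (le_trans (flat_le _ hl))//.
    rewrite gtr0_norm// expr2 mulrA ler_pM2r//.
    by rewrite mulrC -ler_pdivlMr// -(gtr0_norm hl).
  apply: DeriveDef; first by apply/cvg_ex; exists 0.
  by apply/cvg_lim.
Unshelve. all: end_near. Qed.
Lemma smooth_flat k : smooth (flat k).
Proof.
apply/smoothP => n; elim: n k => // n IH k.
split=> [x|]; first by have [] := flat_derive k x.
rewrite (_ : derive1 _ = fun x => flat k.+2 x + (- k%:R) * flat k.+1 x).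
  by apply: ckD => //; apply: ckM => //; exact: ck_cst.
by apply/funext => x; rewrite (is_derive1E (flat_derive k x)) mulNr.
Qed.

(** The usual smooth transition from 0 on the negative axis to 1 beyond 1. The denominator never
    vanishes, since [x] and [1 - x] cannot both be nonpositive. *)
Definition step x : R := flat 0 x / (flat 0 x + flat 0 (1 - x)).

Lemma step_den_gt0 x : 0 < flat 0 x + flat 0 (1 - x).
Proof.
have [x0|x0] := ltP 0 x; first by rewrite ltr_wpDr ?flat_ge0// flat0_gt0.
by rewrite ltr_wpDl ?flat_ge0// flat0_gt0//; lra.
Qed.

Lemma smooth_step : smooth step.
Proof.
have s1 : smooth (fun x => flat 0 (1 - x)).
  rewrite (_ : (fun x => _) = fun x => flat 0 (-1 * x + 1)); last first.
    by apply/funext => x; rewrite mulN1r addrC.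
  by apply: smooth_affine; exact: smooth_flat.
apply: smoothM; first exact: smooth_flat.
apply: smoothV; first by move=> x; rewrite gt_eqF// step_den_gt0.
exact: smoothD (@smooth_flat 0) s1.
Qed.

Lemma step_le0 x : x <= 0 -> step x = 0.
Proof. by move=> x0; rewrite /step flat_le0// mul0r. Qed.

Lemma step_ge1 x : 1 <= x -> step x = 1.
Proof.
move=> x1; rewrite /step [flat 0 (1 - x)]flat_le0 ?subr_le0// addr0 divff//.
by rewrite gt_eqF// flat0_gt0//; lra.
Qed.

Lemma step_ge0 x : 0 <= step x.
Proof. by rewrite divr_ge0 ?flat_ge0// ltW// step_den_gt0. Qed.

Lemma step_le1 x : step x <= 1.
Proof. by rewrite ler_pdivrMr ?step_den_gt0// mul1r lerDl flat_ge0. Qed.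

Lemma flat0_homo : {homo flat 0 : x y / x <= y}.
Proof.
move=> x y xy; rewrite /flat !expr0 !mul1r.
case: ifPn => x0; last by case: ifPn => // y0; exact: expR_ge0.
have y0 := lt_le_trans x0 xy.
by rewrite y0 ler_expR lerN2 lef_pV2.
Qed.

(** After cross-multiplication the product [flat 0 x * flat 0 y] cancels; the rest is the
    monotonicity of [flat 0], applied to [x <= y] and to [1 - y <= 1 - x]. *)
Lemma step_homo : {homo step : x y / x <= y}.
Proof.
move=> x y xy; rewrite /step ler_pdivrMr ?step_den_gt0//.
rewrite mulrAC ler_pdivlMr ?step_den_gt0// !mulrDr [X in X + _ <= _]mulrC lerD2l.
by apply: ler_pM; rewrite ?flat_ge0 ?flat0_homo// lerB.
Qed.

(** Makes [derive1 step] a mollifier: nonnegative, zero outside [[0, 1]] and of total mass 1. *)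
Lemma dstep_ge0 x : 0 <= derive1 step x.
Proof.
rewrite derive1E; have [dx _] := smooth_derivable smooth_step x.
apply: limr_ge => //; near=> h.
have h0 : h != 0 by near: h; exact: nbhs_dnbhs_neq.
rewrite -[h%:A]/(h * 1) mulr1 /=.
have [hl|hl|/eqP] := ltgtP h 0; last by rewrite (negbTE h0).
- by rewrite -[_ *: _]/(_ * _) nmulr_rge0 ?invr_lt0// subr_le0 step_homo// gerDr ltW.
- by rewrite -[_ *: _]/(_ * _) pmulr_rge0 ?invr_gt0// subr_ge0 step_homo// lerDr ltW.
Unshelve. all: end_near. Qed.

Lemma dstep_out x : (x < 0) || (1 < x) -> derive1 step x = 0.
Proof.
case/orP => x0; apply: is_derive1E.
- apply: (@near_eq_is_derive _ _ _ (cst 0)).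
  by near=> y; rewrite step_le0// ltW//; near: y; exact: lt_nbhsl.
- apply: (@near_eq_is_derive _ _ _ (cst (1 : R))).
  by near=> y; rewrite step_ge1// ltW//; near: y; exact: lt_nbhsr.
Unshelve. all: end_near. Qed.

Lemma dstep_bounded : exists2 C : R, 0 < C & forall x, derive1 step x <= C.
Proof.
have [|c _ cP] := @EVT_max R (derive1 step) 0 1 ler01.
  apply: continuous_subspaceT; apply: smooth_continuous.
  by apply: smooth_derive; exact: smooth_step.
exists (derive1 step c + 1) => [|x]; first by rewrite ltr_wpDl// dstep_ge0.
have [/cP|] := boolP (x \in `[0, 1]%R); first by move=> h; rewrite (le_trans h)// lerDl.
rewrite in_itv/= negb_and -!ltNge => /dstep_out ->.
by rewrite addr_ge0 ?dstep_ge0.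
Qed.

Lemma tsupport_sub f a b : (forall x, x \notin `[a, b]%R -> f x = 0) ->
  tsupport f `<=` `[a, b].
Proof.
move=> f0; have ->: `[a, b]%classic = closure `[a, b].
  by apply/closure_id; exact: interval_closed.
apply: closureS => x /=; apply: contraNT => /f0 ->; exact: eqxx.
Qed.

Lemma tsupport_compact f a b : (forall x, x \notin `[a, b]%R -> f x = 0) ->
  compact (tsupport f).
Proof.
move=> f0; apply: (subclosed_compact _ (@segment_compact _ a b)).
  exact: closed_closure.
exact: tsupport_sub.
Qed.

End SmoothStep.

(** * Weak derivatives and Sobolev bounds *)

Section Integrals.
Context {R : realType}.
Implicit Types (f g F : R -> R) (a b c x y : R).
Local Notation mu := (@lebesgue_measure R).

Lemma continuous_integrable_seg f a b : continuous f ->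
  mu.-integrable `[a, b] (EFin \o f).
Proof.
move=> cf; apply: continuous_compact_integrable; first exact: segment_compact.
exact: continuous_subspaceT.
Qed.

Lemma locally_integrable_seg f a b : locally_integrable [set: R] f ->
  mu.-integrable `[a, b] (EFin \o f).
Proof.
move=> [mf _ fi]; apply/integrableP; split.
  by apply/measurable_EFinP; exact: measurable_funS mf.
by apply: fi => //; exact: segment_compact.
Qed.

Lemma continuous_locally_integrable f : continuous f ->
  locally_integrable [set: R] f.
Proof.
move=> cf; split => //; first exact: continuous_measurable_fun.
  exact: openT.
move=> K _ cK; have /integrableP[_] := @continuous_compact_integrable R f K cK
  (continuous_subspaceT cf).
by [].
Qed.

Lemma Rintegral_support f a b : (forall x, x \notin `[a, b]%R -> f x = 0) ->
  \int[mu]_(x in [set: R]) f x = \int[mu]_(x in `[a, b]) f x.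
Proof.
move=> f0; rewrite [RHS]Rintegral_mkcond; congr (fine _).
apply: eq_integral => x _; congr (_%:E); rewrite patchE; case: ifPn => // xab.
by apply: f0; apply: contra xab => xab; rewrite inE.
Qed.

Lemma Rintegral_FTC f F a b : a <= b -> continuous f ->
  (forall x, is_derive x 1 F (f x)) ->
  \int[mu]_(x in `[a, b]) f x = F b - F a.
Proof.
move=> ab cf dF; move: ab; rewrite le_eqVlt => /predU1P[->|ab].
  by rewrite set_itv1 Rintegral_set1 subrr.
have cF : continuous F by move=> x; exact: is_derive_continuous (dF x).
rewrite /Rintegral (@continuous_FTC2 _ f F)//.
- exact: continuous_subspaceT.
- split; first by move=> x _; have [] := dF x.
  + exact: cvg_at_right_filter (cF a).
  + exact: cvg_at_left_filter (cF b).
- by move=> x _; exact: is_derive1E (dF x).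
Qed.

Lemma integrable_segD f g a b : mu.-integrable `[a, b] (EFin \o f) ->
  mu.-integrable `[a, b] (EFin \o g) ->
  mu.-integrable `[a, b] (EFin \o (fun x => f x + g x)).
Proof.
move=> fi gi; have -> : EFin \o (fun x => f x + g x) = ((EFin \o f) \+ (EFin \o g))%E.
  by apply/funext => x /=; rewrite EFinD.
exact: integrableD.
Qed.

Lemma integrable_segB f g a b : mu.-integrable `[a, b] (EFin \o f) ->
  mu.-integrable `[a, b] (EFin \o g) ->
  mu.-integrable `[a, b] (EFin \o (fun x => f x - g x)).
Proof.
move=> fi gi; have -> : EFin \o (fun x => f x - g x) = ((EFin \o f) \- (EFin \o g))%E.
  by apply/funext => x /=; rewrite EFinB.
exact: integrableB.
Qed.

Lemma integrable_segM f g a b : continuous g ->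
  mu.-integrable `[a, b] (EFin \o f) ->
  mu.-integrable `[a, b] (EFin \o (fun x => f x * g x)).
Proof.
move=> cg fi; rewrite (_ : EFin \o _ = (EFin \o f) \* (EFin \o g))%E; last first.
  by apply/funext => x /=; rewrite EFinM.
apply: integrableMl => //.
- by apply: measurable_funS (continuous_measurable_fun cg).
- have /compact_bounded := continuous_compact (continuous_subspaceT cg) (@segment_compact _ a b).
  move=> [M [Mr MP]]; exists M; split => // N MN x xab; apply: (MP _ MN).
  by exists x.
Qed.

End Integrals.

(** * Mollification at Lebesgue points *)

Section WeakDerivative.
Context {R : realType}.
Implicit Types (f g : R -> R) (a b c x y m : R).
Local Notation mu := (@lebesgue_measure R).

Lemma cvge0_lt {T : Type} (F : set_system T) {FF : Filter F} (h : T -> \bar R)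
    (e : R) : h x @[x --> F] --> 0%E -> 0 < e -> \forall x \near F, (h x < e%:E)%E.
Proof.
move=> h0 e0; apply: (h0 [set y | (y < e%:E)%E]).
by apply: open_nbhs_nbhs; split; [exact: open_ereal_lt_ereal|rewrite /= lte_fin].
Qed.

(** For positive [m] the transition takes place on [[a, a + m^-1]], to the right of [a]; the
    derivative is a one-sided approximation of the Dirac mass at [a]. *)
Definition rescaled_step m a x : R := step (m * x + - (m * a)).

Lemma smooth_rescaled_step m a : smooth (rescaled_step m a).
Proof. by apply: smooth_affine; exact: smooth_step. Qed.

Lemma derive1_rescaled_step m a x :
  derive1 (rescaled_step m a) x = derive1 step (m * x + - (m * a)) * m.
Proof.
apply: is_derive1E; apply: is_derive_chain; last exact: is_derive_affine.
exact: smooth_derivable smooth_step _.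
Qed.

Lemma derive1_rescaled_step_out m a x : 0 < m -> x \notin `[a, a + m^-1]%R ->
  derive1 (rescaled_step m a) x = 0.
Proof.
move=> m0; rewrite in_itv/= negb_and -!ltNge => xa.
rewrite derive1_rescaled_step dstep_out ?mul0r// -mulrBr.
rewrite pmulr_rlt0// subr_lt0 -ltr_pdivrMl// mulr1 ltrBrDl.
by [].
Qed.

Lemma rescaled_step_le m a x : 0 < m -> x <= a -> rescaled_step m a x = 0.
Proof. by move=> m0 xa; rewrite /rescaled_step step_le0// subr_le0 ler_pM2l. Qed.

Lemma rescaled_step_ge m a x : 0 < m -> a + m^-1 <= x -> rescaled_step m a x = 1.
Proof.
by move=> m0 xa; rewrite /rescaled_step step_ge1// -mulrBr -ler_pdivrMl// mulr1 lerBrDl.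
Qed.

(** The kernel has mass 1, is at most [C * m] and lives on an interval of length [m^-1]. Hence the
    integral differs from [f a] by at most a multiple of the mean deviation of [f] around [a], which
    tends to 0 at a Lebesgue point. *)
Lemma lebesgue_pt_rescaled_step f a : locally_integrable [set: R] f ->
  lebesgue_pt f a ->
  (\int[mu]_(x in [set: R]) (f x * derive1 (rescaled_step n.+1%:R a) x))
    @[n --> \oo] --> f a.
Proof.
move=> lf la; have [C C0 CP] := @dstep_bounded R.
pose I n : R := \int[mu]_(x in [set: R]) (f x * derive1 (rescaled_step n.+1%:R a) x).
(* The radius [2 / m] lets the open ball contain the closed interval [[a, a + m^-1]]; its measure
   [4 / m] accounts for the factor 4. *)
have key n : ((`|I n - f a|)%:E <= (4 * C)%:E * davg f a (2 / n.+1%:R))%E.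
  set m : R := n.+1%:R; have m0 : 0 < m by rewrite ltr0n.
  pose w := derive1 (rescaled_step m a).
  have cw : continuous w.
    by apply: smooth_continuous; apply: smooth_derive; exact: smooth_rescaled_step.
  have w0 x : x \notin `[a, a + m^-1]%R -> w x = 0 by exact: derive1_rescaled_step_out.
  have aam : a <= a + m^-1 by rewrite lerDl invr_ge0 ltW.
  have wi : \int[mu]_(x in `[a, a + m^-1]) w x = 1.
    rewrite (Rintegral_FTC aam cw (smooth_derivable (@smooth_rescaled_step m a))).
    by rewrite rescaled_step_ge// rescaled_step_le// subr0.
  rewrite /I (Rintegral_support (a := a) (b := a + m^-1)); last first.
    by move=> x /w0; rewrite /w => ->; rewrite mulr0.
  have fi := @locally_integrable_seg R f a (a + m^-1) lf.
  have -> : f a = \int[mu]_(x in `[a, a + m^-1]) (f a * w x).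
    rewrite RintegralZl ?wi ?mulr1//; exact: continuous_integrable_seg.
  have fwi := integrable_segM cw fi.
  rewrite -RintegralB//; last first.
    by apply: continuous_integrable_seg => x; apply: cvgM; [exact: cvg_cst|exact: cw].
  have m2 : 0 <= 2 / m by rewrite divr_ge0// ltW.
  have mfa : measurable_fun [set: R] (fun x => (`|(f x - f a)%:E|)%E).
    apply: measurableT_comp => //; apply/measurable_EFinP; apply: measurable_funB => //.
    by case: lf.
  have -> : ((4 * C)%:E * davg f a (2 / m) =
      (C * m)%:E * \int[mu]_(x in ball a (2 / m)) `|(f x - f a)%:E|)%E.
    rewrite /davg /iavg lebesgue_measure_ball// inver.
    rewrite gt_eqF ?pmulrn_lgt0 ?divr_gt0// muleA -EFinM; congr (_%:E * _)%E.
    by rewrite -mulr_natl; field; rewrite ?gt_eqF.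
  have di : mu.-integrable `[a, a + m^-1] (EFin \o (fun x => f x * w x - f a * w x)).
    apply: integrable_segB => //; apply: continuous_integrable_seg => x.
    by apply: cvgM; [exact: cvg_cst|exact: cw].
  rewrite EFin_normr_Rintegral//.
  apply: (le_trans (le_abse_integral _ _ _)) => //; first by case/integrableP: di.
  apply: (@le_trans _ _ (\int[mu]_(x in `[a, (a + m^-1)%R]) ((C * m)%:E * `|(f x - f a)%:E|))%E).
    apply: ge0_le_integral => //.
    - by apply: measurableT_comp => //; case/integrableP: di.
    - apply: emeasurable_funM; first exact: measurable_cst.
      exact: measurable_funS mfa.
    - move=> x _; rewrite /= lee_fin -mulrBl normrM mulrC ler_wpM2r//.
      rewrite /w derive1_rescaled_step normrM (gtr0_norm m0) ger0_norm ?dstep_ge0//.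
      by rewrite ler_wpM2r// ltW.
  have Cm : 0 <= C * m by rewrite mulr_ge0// ltW.
  rewrite ge0_integralZl_EFin//; last exact: measurable_funS mfa.
  apply: lee_wpmul2l; first by rewrite lee_fin.
  apply: ge0_subset_integral => //.
  - exact: measurable_ball.
  - exact: measurable_funS mfa.
  - move=> x /=; rewrite in_itv/= => /andP[ax xa].
    rewrite /ball/= distrC ger0_norm ?subr_ge0// ltrBlDl (le_lt_trans xa)//.
    by rewrite ltrD2l ltr_pMl ?invr_gt0// ltr1n.
apply/cvgrPdist_lt => e e0.
have e1 : 0 < e / (4 * C) by rewrite divr_gt0// mulr_gt0.
have [d /= d0 dP] := cvge0_lt la e1.
near=> n.
rewrite distrC -lte_fin (le_lt_trans (key n))//.
have n0 : 0 < 2 / n.+1%:R :> R by rewrite divr_gt0.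
have nd : 2 / n.+1%:R < d.
  rewrite mulrC -ltr_pdivlMr//; near: n.
  have d2 : 0 < d / 2 by rewrite divr_gt0.
  exact: (near_infty_natSinv_lt (PosNum d2)).
have : (davg f a (2 / n.+1%:R) < (e / (4 * C))%:E)%E.
  by apply: dP => //; rewrite /ball/= sub0r normrN gtr0_norm.
rewrite -(@lte_pmul2l _ (4 * C)%:E)// ?lte_fin ?mulr_gt0//.
by rewrite -EFinM [_ * (e / _)]mulrC divfK// gt_eqF// mulr_gt0.
Unshelve. all: end_near. Qed.

End WeakDerivative.

(** * Testing against smoothed indicator functions *)

Section WeakFTC.
Context {R : realType}.
Implicit Types (f g : R -> R) (a b c x y m : R).
Local Notation mu := (@lebesgue_measure R).

(* Smooth approximations of the indicator function of ]a, b]. *)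
Definition plateau n a b x : R :=
  rescaled_step n.+1%:R a x - rescaled_step n.+1%:R b x.

Lemma derive1_plateau n a b x : derive1 (plateau n a b) x =
  derive1 (rescaled_step n.+1%:R a) x - derive1 (rescaled_step n.+1%:R b) x.
Proof.
apply: is_derive1E; apply: is_derive_sub.
  exact: smooth_derivable (@smooth_rescaled_step R _ a) x.
exact: smooth_derivable (@smooth_rescaled_step R _ b) x.
Qed.

Lemma smooth_plateau n a b : smooth (plateau n a b).
Proof.
rewrite (_ : plateau n a b = fun x =>
    rescaled_step n.+1%:R a x + (-1) * rescaled_step n.+1%:R b x).
  apply: smoothD; first exact: smooth_rescaled_step.
  by apply: smoothM; [exact: smooth_cst|exact: smooth_rescaled_step].
by apply/funext => x; rewrite mulN1r.
Qed.

Lemma plateau_out n a b x : a <= b -> x \notin `[a, b + 1]%R -> plateau n a b x = 0.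
Proof.
move=> ab; have n0 : 0 < n.+1%:R :> R by rewrite ltr0n.
have n1 : n.+1%:R^-1 <= 1 :> R by rewrite invf_le1// ler1n.
rewrite in_itv/= negb_and -!ltNge /plateau => /orP[xa|bx].
  by rewrite !rescaled_step_le ?subrr// ltW// (lt_le_trans xa).
have bx' : b + n.+1%:R^-1 <= x by rewrite (le_trans _ (ltW bx))// lerD2l.
by rewrite !rescaled_step_ge ?subrr// (le_trans _ bx')// lerD2r.
Qed.

Lemma normr_plateau_le1 n a b x : `|plateau n a b x| <= 1.
Proof.
rewrite /plateau /rescaled_step ler_norml.
have := step_ge0 (n.+1%:R * x + - (n.+1%:R * a)).
have := step_le1 (n.+1%:R * x + - (n.+1%:R * a)).
have := step_ge0 (n.+1%:R * x + - (n.+1%:R * b)).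
have := step_le1 (n.+1%:R * x + - (n.+1%:R * b)).
lra.
Qed.

Lemma test_plateau n a b : a <= b -> test_function (plateau n a b).
Proof.
move=> ab; split; first exact: smooth_plateau.
by apply: (@tsupport_compact _ _ a (b + 1)) => x; exact: plateau_out.
Qed.

(** At a fixed point the sequence is eventually constant, because the transition zones shrink to [a]
    and [b] from the right. This one-sidedness excludes [a] from the limit set and includes [b]. *)
Lemma plateau_cvg a b x : a <= b ->
  \forall n \near \oo, plateau n a b x = (x \in `]a, b]%R)%:R.
Proof.
move=> ab; have S n : 0 < n.+1%:R :> R by rewrite ltr0n.
have big c : c < x -> \forall n \near \oo, rescaled_step n.+1%:R c x = 1.
  move=> cx; have xc : 0 < x - c by rewrite subr_gt0.
  near=> n; rewrite rescaled_step_ge// -lerBrDl ltW//.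
  by near: n; exact: (near_infty_natSinv_lt (PosNum xc)).
have small c : x <= c -> \forall n \near \oo, rescaled_step n.+1%:R c x = 0.
  by move=> cx; near=> n; rewrite rescaled_step_le.
rewrite in_itv/=; have [ax|xa] := ltP a x; last first.
  near=> n; rewrite /plateau.
  have -> : rescaled_step n.+1%:R a x = 0 by near: n; exact: small.
  have -> : rescaled_step n.+1%:R b x = 0 by near: n; apply: small; exact: le_trans ab.
  by rewrite subrr.
have [xb|bx] /= := leP x b.
  near=> n; rewrite /plateau.
  have -> : rescaled_step n.+1%:R a x = 1 by near: n; exact: big.
  have -> : rescaled_step n.+1%:R b x = 0 by near: n; exact: small.
  by rewrite subr0.
near=> n; rewrite /plateau.
have -> : rescaled_step n.+1%:R a x = 1 by near: n; exact: big.
have -> : rescaled_step n.+1%:R b x = 1 by near: n; exact: big.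
by rewrite subrr.
Unshelve. all: end_near. Qed.

(** Dominated convergence with majorant |g|. All plateaus live in [[a, b + 1]], as the transition at
    [b] has width at most 1. *)
Lemma Rintegral_plateau g a b : a <= b -> locally_integrable [set: R] g ->
  \int[mu]_(x in [set: R]) (g x * plateau n a b x) @[n --> \oo]
    --> \int[mu]_(x in `[a, b]) g x.
Proof.
move=> ab lg.
have gi : mu.-integrable `[a, b + 1] (EFin \o g) by exact: locally_integrable_seg.
have mg : measurable_fun [set: R] g by case: lg.
have -> : \int[mu]_(x in `[a, b]) g x = \int[mu]_(x in `[a, b + 1]) (g \_ `]a, b]) x.
  rewrite -Rintegral_mkcondr -Rintegral_itv_obnd_cbnd; last first.
    by apply: integrableS (locally_integrable_seg a b lg) => //; exact: subset_itv_oc_cc.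
  congr (fine _); congr (integral _ _ _); apply/seteqP; split => x /=; rewrite !in_itv/=.
    by move=> /andP[ax xb]; rewrite (ltW ax) ax xb; split => //; lra.
  by case.
have [] := @dominated_convergence _ _ _ mu `[a, b + 1] _
  (fun n x => (g x * plateau n a b x)%:E) (EFin \o (g \_ `]a, b])) (fun x => `|g x|%:E).
- by [].
- move=> n; apply/measurable_EFinP; apply: (@measurable_funS _ _ _ _ setT) => //.
  apply: measurable_funM => //; apply: continuous_measurable_fun.
  by apply: smooth_continuous; exact: smooth_plateau.
- apply/measurable_EFinP; apply: (@measurable_funS _ _ _ _ setT) => //.
  by apply/(measurable_restrictT _ _).1 => //; exact: measurable_funS mg.
- apply: aeW => x _; apply: cvg_near_cst.
  apply: filterS (plateau_cvg x ab) => n -> /=; congr (_%:E).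
  by rewrite patchE mem_setE; case: (x \in `]a, b]%R) => /=; rewrite ?mulr1 ?mulr0.
- exact: integrable_norm.
- apply: aeW => x n _; rewrite lee_fin normrM ler_piMr//.
  exact: normr_plateau_le1.
move=> hi _; rewrite -[X in _ --> X]fineK; last exact: integrable_fin_num.
move=> /fine_cvg; apply: cvg_trans.
  apply: near_eq_cvg; near=> n => /=.
  rewrite -[RHS]/(\int[mu]_(x in [set: R]) (g x * plateau n a b x)).
  rewrite (Rintegral_support (a := a) (b := b + 1))// => x xab.
  by rewrite plateau_out// mulr0.
Unshelve. all: end_near. Qed.

End WeakFTC.

(** * Classical derivatives from weak ones *)

Section WeakC1.
Context {R : realType}.
Implicit Types (f g h : R -> R) (a b c x y m : R).
Local Notation mu := (@lebesgue_measure R).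

Lemma continuous_lebesgue_point f a : continuous f -> lebesgue_pt f a.
Proof.
move=> cf; apply: (@continuous_lebesgue_pt _ _ _ setT) => //.
- by split => //; exact: openT.
- exact: continuous_measurable_fun.
- exact: cf.
Qed.

(* Stated at Lebesgue points so that it also applies to a weak derivative, which
   is not known to be continuous. *)
Lemma weak_FTC f g a b : is_weak_derivative 1 f g -> a < b ->
  lebesgue_pt f a -> lebesgue_pt f b ->
  f b - f a = \int[mu]_(x in `[a, b]) g x.
Proof.
move=> [lf lg wfg] ab fa fb.
(* Tested against a plateau, the weak identity shows two mollifiers on the left, which recover the
   values of [f], and a smoothed indicator on the right. *)
have key n : \int[mu]_(x in [set: R]) (f x * derive1 (rescaled_step n.+1%:R a) x) -
    \int[mu]_(x in [set: R]) (f x * derive1 (rescaled_step n.+1%:R b) x) =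
    - \int[mu]_(x in [set: R]) (g x * plateau n a b x).
  have := wfg _ (test_plateau n (ltW ab)); rewrite expr1 mulN1r => <-.
  have n0 : 0 < n.+1%:R :> R by rewrite ltr0n.
  have n1 : n.+1%:R^-1 <= 1 :> R by rewrite invf_le1// ler1n.
  have sub c x : a <= c <= b -> x \notin `[a, b + 1]%R ->
      derive1 (rescaled_step n.+1%:R c) x = 0.
    move=> /andP[ac cb] xab; apply: derive1_rescaled_step_out => //.
    apply: contra xab; rewrite !in_itv/= => /andP[cx xc].
    rewrite (le_trans ac cx) (le_trans xc)//.
    exact: lerD.
  have fi c : mu.-integrable `[a, b + 1]
      (EFin \o (fun x => f x * derive1 (rescaled_step n.+1%:R c) x)).
    apply: integrable_segM; last exact: locally_integrable_seg.
    by apply: smooth_continuous; apply: smooth_derive; exact: smooth_rescaled_step.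
  rewrite !(Rintegral_support (a := a) (b := b + 1)); first last.
  - by move=> x xab; rewrite sub ?mulr0// lexx ltW.
  - by move=> x xab; rewrite sub ?mulr0// lexx ltW.
  - by move=> x xab; rewrite /= derive1_plateau !sub ?subr0 ?mulr0// lexx ltW.
  rewrite -RintegralB//; apply: eq_Rintegral => x _.
  by rewrite /= derive1_plateau mulrBr.
have := cvgB (lebesgue_pt_rescaled_step lf fa) (lebesgue_pt_rescaled_step lf fb).
have := cvgN (Rintegral_plateau (ltW ab) lg).
move=> c1 c2; apply: oppr_inj; rewrite opprB.
have {}c1 := c1 ltac:(typeclasses eauto); have {}c2 := c2 ltac:(typeclasses eauto).
rewrite -(cvg_lim _ c1)//; apply/esym/cvg_lim => //.
by move: c2; apply: cvg_trans; apply: near_eq_cvg; apply: nearW => n; exact: key.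
Qed.

(** [derive1 phi] is again a test function: the first hypothesis tested with it and the second
    tested with [phi] share the integral of [f] against the second derivative of [phi]. *)
Lemma is_weak_derivative_iter f g h : is_weak_derivative 1 f g ->
  is_weak_derivative 2 f h -> is_weak_derivative 1 g h.
Proof.
move=> [lf lg fg] [_ lh fh]; split => // phi tphi.
have tdphi : test_function (derive1 phi).
  split; first by move=> n x; rewrite -derive1Sn; exact: tphi.1.
  apply: (subclosed_compact _ tphi.2); first exact: closed_closure.
  have cs : closed (tsupport phi) by exact: closed_closure.
  have -> : tsupport phi = closure (tsupport phi) by apply/closure_id.
  apply: closureS => x /=; apply: contra_neqP => xs.
  apply: is_derive1E; apply: (@near_eq_is_derive _ _ _ (cst 0)).
  have := open_nbhs_nbhs (conj (closed_openC cs) xs).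
  apply: filterS => y ys; apply/esym/eqP; apply: contrapT => /negP yn0.
  by apply: ys; exact: subset_closure.
have e1 := fg _ tdphi; have e2 := fh _ tphi.
rewrite expr1 mulN1r in e1; rewrite sqrrN expr1n mul1r in e2.
by rewrite expr1 mulN1r -e2; apply: oppr_inj; rewrite opprK -e1.
Qed.

(** A null set cannot contain the interval from [x - 1] to [x]. *)
Lemma ae_exists_lt (P : R -> Prop) x : {ae mu, forall y, P y} -> exists2 a, a < x & P a.
Proof.
move=> [N [mN N0 NP]]; apply: contrapT => /forall2NP h.
have : (mu `](x - 1)%R, x[%classic <= mu N)%E.
  apply: le_measure; rewrite ?inE//= => y /=; rewrite in_itv/= => /andP[_ yx].
  by apply: NP => /= Py; case: (h y).
rewrite N0 lebesgue_measure_itv/= lte_fin ltrBlDr ltrDl ltr01.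
by rewrite -EFinB opprB addrC subrK lee_fin ler10.
Qed.

(** [g] is determined only almost everywhere, so the base point [a] has to be a Lebesgue point of
    [g]. To the right of [a], the primitive of [h] with value [g a] at [a] agrees with [g] almost
    everywhere; being continuous, it is the classical derivative of [f] there. *)
Lemma weak_derivative_local f g h x : continuous f -> is_weak_derivative 1 f g ->
  is_weak_derivative 2 f h ->
  exists2 a, a < x & lebesgue_pt g a /\
  (forall y, a < y ->
     is_derive y 1 f (g a + \int[mu]_(t in `[a, y]) h t) /\
     {for y, continuous (fun y => g a + \int[mu]_(t in `[a, y]) h t)}).
Proof.
move=> cf fg fh; have gh := is_weak_derivative_iter fg fh.
have [_ lg _] := fg; have [_ lh _] := fh.
have [a ax ga] := ae_exists_lt x (lebesgue_differentiation lg).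
exists a => //; split => // y ay.
pose k y := g a + \int[mu]_(t in `[a, y]) h t.
have ck u : a <= u -> {within `[a, u], continuous k}.
  move=> au z; apply: cvgD; first exact: cvg_cst.
  exact: (parameterized_integral_continuous au (locally_integrable_seg a u lh)).
have cky z : a < z -> {for z, continuous k}.
  move=> az; have zz1 : z < z + 1 by rewrite ltrDl.
  have [+ _ _] := (continuous_within_itvP _ (lt_trans az zz1)).1
    (ck _ (ltW (lt_trans az zz1))).
  by apply; rewrite in_itv/= az.
have ki u : mu.-integrable `[a, u] (EFin \o k).
  have [au|ua] := leP a u.
    by apply: continuous_compact_integrable; [exact: segment_compact|exact: ck].
  by rewrite set_itv_ge ?bnd_simp -?ltNge//; exact: integrable_set0.
have gk : {ae mu, forall z, a <= z -> g z = k z}.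
  have := lebesgue_differentiation lg.
  apply: filterS; first exact: (ae_filter_ringOfSetsType mu).
  move=> z gz.
  rewrite le_eqVlt => /predU1P[<-|az].
    by rewrite /k set_itv1 Rintegral_set1 addr0.
  by rewrite /k -(weak_FTC gh az ga gz) addrC subrK.
have fk z : a < z -> f z = f a + \int[mu]_(t in `[a, z]) k t.
  move=> az.
  rewrite -[LHS](subrK (f a)) addrC; congr (_ + _).
  rewrite (weak_FTC fg az); [|exact: continuous_lebesgue_point..].
  have gi := locally_integrable_seg a z lg.
  congr (fine _); apply: ae_eq_integral => //.
  - by case/integrableP: gi.
  - by case/integrableP: (ki z).
  - move: gk; apply: filterS; first exact: (ae_filter_ringOfSetsType mu).
    move=> t + /=; rewrite in_itv/= => gkt /andP[au _]; by rewrite gkt.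
split; last exact: cky.
have yy1 : y < y + 1 by rewrite ltrDl.
have [dF F'] := continuous_FTC1_closed yy1 (ki _) ay (cky _ ay).
apply: (@near_eq_is_derive _ _ _ (fun z => f a + \int[mu]_(t in `[a, z]) k t)).
  by near=> z; rewrite [RHS]fk//; near: z; exact: lt_nbhsr.
have := is_derive_add (is_derive_cst (f a) y 1) (derivable_is_derive1 dF).
by rewrite add0r F'.
Unshelve. all: end_near. Qed.

End WeakC1.

(** * Sup norm bounds by L^2 norms *)

Section Sobolev.
Context {R : realType}.
Implicit Types (f g h : R -> R) (a b c x y m : R).
Local Notation mu := (@lebesgue_measure R).

(** Every point has a base point to its left to which [weak_derivative_local] applies. All the local
    formulas compute the same function [derive1 f], so no gluing is required. *)
Lemma weak_derivative_C1 f g h : continuous f -> is_weak_derivative 1 f g ->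
  is_weak_derivative 2 f h ->
  [/\ forall x, is_derive x 1 f (derive1 f x), continuous (derive1 f),
      {ae mu, forall x, g x = derive1 f x} &
      forall a b, a < b -> derive1 f b - derive1 f a = \int[mu]_(x in `[a, b]) h x].
Proof.
move=> cf fg fh; have lh : locally_integrable setT h by case: fh.
have L x := weak_derivative_local x cf fg fh.
have dE x a : a < x -> lebesgue_pt g a /\ (forall y, a < y ->
     is_derive y 1 f (g a + \int[mu]_(t in `[a, y]) h t) /\
     {for y, continuous (fun y => g a + \int[mu]_(t in `[a, y]) h t)}) ->
  derive1 f x = g a + \int[mu]_(t in `[a, x]) h t.
  by move=> ax [_ /(_ x ax)[dx _]]; exact: is_derive1E dx.
split.
- move=> x; have [a ax H] := L x; rewrite (dE _ _ ax H).
  by have [] := H.2 _ ax.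
- move=> x; have [a ax H] := L x.
  have [_ cx] := H.2 _ ax; rewrite /continuous_at (dE _ _ ax H).
  apply: cvg_trans cx; apply: near_eq_cvg; near=> y; apply/esym/dE => //.
  by near: y; exact: lt_nbhsr.
- have [_ lg _] := fg; have := lebesgue_differentiation lg.
  apply: filterS; first exact: (ae_filter_ringOfSetsType mu).
  move=> x gx; have [a ax H] := L x; rewrite (dE _ _ ax H).
  by rewrite -(weak_FTC (is_weak_derivative_iter fg fh) ax H.1 gx) addrC subrK.
- move=> a b ab; have [c ca H] := L a.
  rewrite (dE _ _ ca H) (dE _ _ (lt_trans ca ab) H) opprD addrACA subrr add0r.
  rewrite Rintegral_itvB ?bnd_simp ?ltW//; last exact: locally_integrable_seg.
  rewrite Rintegral_itv_obnd_cbnd//.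
  by apply: integrableS (locally_integrable_seg a b lh) => //; exact: subset_itv_oc_cc.
Unshelve. all: end_near. Qed.

Lemma lebesgue_measure_seg1 x : mu `[x, (x + 1)%R] = 1%E.
Proof.
by rewrite lebesgue_measure_itv/= lte_fin ltrDl ltr01 -EFinB addrC addKr.
Qed.

(** Hoelder's inequality against the indicator of a unit interval, whose L^2 norm is 1. *)
Lemma integral_seg_le_L2norm f x : measurable_fun [set: R] f ->
  ((\int[mu]_(y in `[x, (x + 1)%R]) `|f y|%:E) <= L2norm f)%E.
Proof.
move=> mf.
have m1 : measurable_fun [set: R] (\1_(`[x, (x + 1)%R]) : R -> R) by exact: measurable_indic.
have := @hoelder _ _ R mu f \1_(`[x, (x + 1)%R]) 2 2 mf m1.
rewrite -div1r -splitr => /(_ (ltr0Sn _ _) (ltr0Sn _ _) erefl).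
rewrite Lnorm1 /L2norm.
have -> : Lnorm mu 2%:E (EFin \o (\1_(`[x, (x + 1)%R]) : R -> R)) = 1%E.
  rewrite unlock.
  have -> : (\int[mu]_y (`|(EFin \o (\1_(`[x, (x + 1)%R]) : R -> R)) y| `^ 2) = 1)%E.
    transitivity (\int[mu]_y (\1_(`[x, (x + 1)%R]) y)%:E)%E.
      apply: eq_integral => y _; rewrite /= indicE; case: (_ \in _) => /=.
        by rewrite normr1 powR1.
      by rewrite normr0 powR0.
    by rewrite integral_indic// setIT; exact: lebesgue_measure_seg1.
  by rewrite poweR_EFin powR1.
rewrite mule1; apply: le_trans.
rewrite le_eqVlt [X in X == _]integral_mkcond; apply/orP; left; apply/eqP.
apply: eq_integral => y _.
by rewrite /= patchE indicE; case: ifP => _; rewrite ?mulr1 ?mulr0 ?normr0.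
Qed.

(** For each [y] in the unit interval starting at [x], |f x| is at most |f y| plus the integral of
    |g| over that interval; averaging over [y] replaces |f y| by its integral. *)
Lemma sup_le_L2norm f g x : measurable_fun [set: R] f ->
  locally_integrable [set: R] f -> locally_integrable [set: R] g ->
  (forall a b, a < b -> f b - f a = \int[mu]_(x in `[a, b]) g x) ->
  ((`|f x|)%:E <= L2norm f + L2norm g)%E.
Proof.
move=> mf lf lg fg.
have mI : fine (mu `[x, (x + 1)%R]) = 1 by rewrite lebesgue_measure_seg1.
have nfi : mu.-integrable `[x, x + 1] (EFin \o (fun y => `|f y|)).
  exact: integrable_norm (locally_integrable_seg _ _ lf).
have ngi : mu.-integrable `[x, x + 1] (EFin \o (fun y => `|g y|)).
  exact: integrable_norm (locally_integrable_seg _ _ lg).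
have pt y : y \in `[x, x + 1]%R -> `|f x| <= `|f y| + \int[mu]_(y in `[x, x + 1]) `|g y|.
  rewrite in_itv/= => /andP[]; rewrite le_eqVlt => /predU1P[<-|xy] yx.
    by rewrite lerDl; apply: Rintegral_ge0.
  have gxy := locally_integrable_seg x y lg.
  have -> : f x = f y - (f y - f x) by rewrite subKr.
  rewrite (le_trans (ler_normB _ _))// lerD2l fg//.
  rewrite (le_trans (le_normr_Rintegral _ _))//.
  rewrite fine_le//.
  - by apply: integrable_fin_num => //; exact: (integrable_norm gxy).
  - exact: integrable_fin_num.
  - apply: ge0_subset_integral => //; first by case/integrableP: ngi.
    exact: subset_itvl.
have : `|f x| <= \int[mu]_(y in `[x, x + 1]) `|f y| + \int[mu]_(y in `[x, x + 1]) `|g y|.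
  have c1 c : mu.-integrable `[x, x + 1] (EFin \o (fun=> c)).
    by apply: continuous_integrable_seg => z; exact: cvg_cst.
  have C c : c = \int[mu]_(y in `[x, x + 1]) c by rewrite Rintegral_cst// mI mulr1.
  rewrite (C `|f x|) (C (\int[mu]_(y in `[x, x + 1]) `|g y|)).
  rewrite -RintegralD//; apply: le_Rintegral => //.
  exact: integrable_segD nfi (c1 _).
rewrite -lee_fin EFinD => /le_trans; apply; apply: leeD.
- rewrite /Rintegral fineK; last exact: integrable_fin_num.
  exact: integral_seg_le_L2norm.
- rewrite /Rintegral fineK; last exact: integrable_fin_num.
  by apply: integral_seg_le_L2norm; case: lg.
Qed.

End Sobolev.

(** * Linearity of weak derivatives and Sobolev norms *)

Section WeakDerivativeTheory.
Context {R : realType}.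
Implicit Types (f g h : R -> R) (a b c x y m : R) (k s : nat).
Local Notation mu := (@lebesgue_measure R).

Lemma derive1n_support k (phi : R -> R) :
  [set x | derive1n k phi x != 0] `<=` tsupport phi.
Proof.
elim: k => [|k IH]; first exact: subset_closure.
move=> x; rewrite /= => dphi; apply: contrapT => xs.
have cs : closed (tsupport phi) by exact: closed_closure.
move/eqP: dphi; apply; apply: is_derive1E.
apply: (@near_eq_is_derive _ _ _ (cst 0)).
have := open_nbhs_nbhs (conj (closed_openC cs) xs).
apply: filterS => y ys; apply/esym/eqP; apply: contrapT => /negP yn0.
by apply: ys; exact: IH.
Qed.

Lemma test_derive1n k (phi : R -> R) : test_function phi ->
  test_function (derive1n k phi).
Proof.
move=> [sphi cphi]; split => [n x|].
  have -> : derive1n n (derive1n k phi) = derive1n (k + n) phi.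
    by elim: n => [|n IH]; rewrite ?addn0// addnS /= IH.
  exact: sphi.
apply: (subclosed_compact _ cphi); first exact: closed_closure.
have -> : tsupport phi = closure (tsupport phi).
  by apply/closure_id; exact: closed_closure.
by apply: closureS; exact: derive1n_support.
Qed.

Lemma test_bounded_support (phi : R -> R) : test_function phi ->
  exists2 K : R, 0 < K & forall k x, x \notin `[- K, K]%R -> derive1n k phi x = 0.
Proof.
move=> [_ /compact_bounded[N [_ NP]]].
have N1 : N < `|N| + 1 by rewrite ltr_pwDr// ler_norm.
exists (`|N| + 1); first by rewrite ltr_wpDl.
move=> k x; rewrite in_itv/= -ler_norml; apply: contraNeq => xs.
exact: (NP _ N1 x (derive1n_support xs)).
Qed.

(** The compact support of [phi] reduces all three integrals to one segment, on which local
    integrability gives integrability. *)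
Lemma Rintegral_testD k (phi : R -> R) c f g : test_function phi ->
  locally_integrable [set: R] f -> locally_integrable [set: R] g ->
  \int[mu]_(x in [set: R]) ((c * f x + g x) * derive1n k phi x) =
  c * \int[mu]_(x in [set: R]) (f x * derive1n k phi x) +
  \int[mu]_(x in [set: R]) (g x * derive1n k phi x).
Proof.
move=> tphi lf lg; have [K K0 KP] := test_bounded_support tphi.
have cphi : continuous (derive1n k phi).
  by apply: smooth_continuous; exact: (test_derive1n k tphi).1.
have fi := integrable_segM cphi (locally_integrable_seg (- K) K lf).
have gi := integrable_segM cphi (locally_integrable_seg (- K) K lg).
rewrite !(Rintegral_support (a := - K) (b := K)); first last.
- by move=> x /(KP k) ->; rewrite mulr0.
- by move=> x /(KP k) ->; rewrite mulr0.
- by move=> x /(KP k) ->; rewrite mulr0.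
have ci : mu.-integrable `[- K, K] (EFin \o (fun x => c * (f x * derive1n k phi x))).
  have -> : EFin \o (fun x => c * (f x * derive1n k phi x)) =
      (fun x => c%:E * (EFin \o (fun x => (f x * derive1n k phi x)%R)) x)%E.
    by apply/funext => x /=; rewrite EFinM.
  exact: integrableZl.
rewrite -RintegralZl// -RintegralD//; apply: eq_Rintegral => x _.
by rewrite mulrDl mulrA.
Qed.

Lemma locally_integrable_lin c f g : locally_integrable [set: R] f ->
  locally_integrable [set: R] g -> locally_integrable [set: R] (fun x => c * f x + g x).
Proof.
move=> [mf _ fi] lg.
have lcf : locally_integrable [set: R] (fun x => c * f x).
  split; [exact: measurable_funM|exact: openT|move=> K KT cK].
  have mK : measurable K by exact: compact_measurable.
  have -> : (\int[mu]_(x in K) `|(c * f x)|%:E =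
      `|c|%:E * \int[mu]_(x in K) `|f x|%:E)%E.
    rewrite -ge0_integralZl_EFin//.
      by apply: eq_integral => x _; rewrite normrM EFinM.
    by apply: measurableT_comp => //; apply: measurableT_comp => //; exact: measurable_funS mf.
  by apply: lte_mul_pinfty => //; exact: fi.
exact: (locally_integrableD lcf lg).
Qed.

Lemma is_weak_derivative_lin k c f1 g1 f2 g2 :
  is_weak_derivative k f1 g1 -> is_weak_derivative k f2 g2 ->
  is_weak_derivative k (fun x => c * f1 x + f2 x) (fun x => c * g1 x + g2 x).
Proof.
move=> [lf1 lg1 h1] [lf2 lg2 h2]; split; try exact: locally_integrable_lin.
move=> phi tphi; rewrite Rintegral_testD// h1// h2//.
have -> : \int[mu]_(x in [set: R]) ((c * g1 x + g2 x) * phi x) =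
    c * \int[mu]_(x in [set: R]) (g1 x * phi x) + \int[mu]_(x in [set: R]) (g2 x * phi x).
  exact: (@Rintegral_testD 0).
by rewrite mulrDr !mulrA [c * _]mulrC.
Qed.

(** [Hs_norm] contains [weak_derivative 0 f], a representative picked by choice that need not be [f]
    itself. At common Lebesgue points the mollifiers, which are test functions, recover both
    values. *)
Lemma weak_derivative0_ae f g : is_weak_derivative 0 f g -> {ae mu, forall x, g x = f x}.
Proof.
move=> [lf lg fg].
have := lebesgue_differentiation lf; have := lebesgue_differentiation lg.
apply: filterS2; first exact: (ae_filter_ringOfSetsType mu).
move=> x gx fx; have f_ := lebesgue_pt_rescaled_step lf fx.
have g_ := lebesgue_pt_rescaled_step lg gx.
rewrite -(cvg_lim _ f_)//; apply/esym/cvg_lim => //.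
move: g_; apply: cvg_trans; apply: near_eq_cvg; apply: nearW => n.
have n0 : 0 < n.+1%:R :> R by rewrite ltr0n.
have tw : test_function (derive1 (rescaled_step n.+1%:R x)).
  split; first by apply: smooth_derive; exact: smooth_rescaled_step.
  by apply: tsupport_compact => y; exact: derive1_rescaled_step_out.
by have := fg _ tw; rewrite expr0 mul1r.
Qed.

Lemma measurable_abse_powR2 f : measurable_fun [set: R] f ->
  measurable_fun [set: R] (fun x => `|(EFin \o f) x| `^ 2)%E.
Proof.
move=> mf; rewrite (_ : (fun x => _) = EFin \o (fun x => `|f x| `^ 2)); last first.
  by apply/funext => x /=.
apply/measurable_EFinP.
apply: (@measurableT_comp _ _ _ _ _ _ (@powR R ^~ 2)) => //.
exact: measurableT_comp.
Qed.

Lemma L2norm_ae f g : measurable_fun [set: R] f -> measurable_fun [set: R] g ->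
  {ae mu, forall x, g x = f x} -> L2norm g = L2norm f.
Proof.
move=> mf mg fg; rewrite /L2norm unlock; congr (_ `^ _)%E.
apply: ae_eq_integral => //.
- by apply: measurable_abse_powR2.
- by apply: measurable_abse_powR2.
- move: fg; apply: filterS; first exact: (ae_filter_ringOfSetsType mu).
  by move=> x /= + _ => ->.
Qed.

Lemma Hs_norm_ge2 s i j f : (i <= s)%N -> (j <= s)%N -> i != j ->
  (L2norm (weak_derivative i f) + L2norm (weak_derivative j f) <= Hs_norm s f)%E.
Proof.
move=> is_ js ij; rewrite /Hs_norm.
rewrite (bigD1 (Ordinal (n := s.+1) is_))//= (bigD1 (Ordinal (n := s.+1) js))/=; last first.
  by rewrite -val_eqE/= eq_sym.
rewrite addeA leeDl//; apply: sume_ge0 => n _; exact: Lnorm_ge0.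
Qed.

Lemma weak_derivativeP k f : (exists g, is_weak_derivative k f g) ->
  is_weak_derivative k f (weak_derivative k f).
Proof. exact: getPex. Qed.

Lemma normr_le_Hs s f x : (1 <= s)%N -> continuous f ->
  (forall k, (k <= 1)%N -> exists g, is_weak_derivative k f g) ->
  ((`|f x|)%:E <= Hs_norm s f)%E.
Proof.
move=> s1 cf wf; have /weak_derivativeP w0 := wf 0%N isT.
have /weak_derivativeP w1 := wf 1%N isT.
have mf := continuous_measurable_fun cf.
apply: le_trans (Hs_norm_ge2 (i := 0) (j := 1) f _ _ _) => //.
have [_ [mw0 _ _] _] := w0; have [_ lw1 _] := w1.
rewrite (L2norm_ae mf mw0 (weak_derivative0_ae w0)).
apply: sup_le_L2norm => //; first exact: continuous_locally_integrable.
by move=> a b ab; apply: weak_FTC w1 ab _ _; exact: continuous_lebesgue_point.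
Qed.

Lemma normr_derive1_le_Hs s f x : (2 <= s)%N -> continuous f ->
  (forall k, (k <= 2)%N -> exists g, is_weak_derivative k f g) ->
  ((`|derive1 f x|)%:E <= Hs_norm s f)%E.
Proof.
move=> s2 cf wf; have /weak_derivativeP w1 := wf 1%N isT.
have /weak_derivativeP w2 := wf 2%N isT.
have [_ cdf aeg fg] := weak_derivative_C1 cf w1 w2.
have mdf := continuous_measurable_fun cdf.
apply: le_trans (Hs_norm_ge2 (i := 1) (j := 2) f _ _ _) => //; last exact: ltnW.
have [_ [mw1 _ _] _] := w1; have [_ lw2 _] := w2.
rewrite (L2norm_ae mdf mw1 aeg).
by apply: sup_le_L2norm => //; exact: continuous_locally_integrable.
Qed.

End WeakDerivativeTheory.

(** * Regularity in time and space *)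

Section TimeRegularity.
Context {R : realType}.
Implicit Types (f g h : R -> R) (F G : R -> R -> R) (a b c x y m t T : R) (k s : nat).

Local Notation timeset T := [set t | 0 <= t < T].

Lemma within_filterS {X : Type} (W : set_system X) {FW : Filter W} (D P Q : set X) :
  (forall z, D z -> P z -> Q z) -> within D W P -> within D W Q.
Proof.
move=> PQ; apply: (@filterS _ _ _ [set z | D z -> P z] [set z | D z -> Q z]).
by move=> z DP Dz; exact: PQ (DP Dz).
Qed.

Lemma cont_Hs_weak s k f : cont_Hs s f -> (k <= s)%N ->
  exists g, is_weak_derivative k f g.
Proof. by move=> [_ fs] /fs [g [fg _]]; exists g. Qed.

Lemma weakB k f g : (exists f', is_weak_derivative k f f') ->
  (exists g', is_weak_derivative k g g') ->
  exists h, is_weak_derivative k (fun x => f x - g x) h.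
Proof.
move=> [f' ff'] [g' gg']; exists (fun x => -1 * g' x + f' x).
rewrite (_ : (fun x => f x - g x) = fun x => -1 * g x + f x).
  exact: is_weak_derivative_lin.
by apply/funext => x; rewrite mulN1r addrC.
Qed.

Lemma weakZ k f c : (exists f', is_weak_derivative k f f') ->
  exists h, is_weak_derivative k (fun x => f x / c) h.
Proof.
(* The quotient is cast as a combination of [f] with itself, the shape to which
   [is_weak_derivative_lin] applies. *)
move=> [f' ff']; exists (fun x => (c^-1 - 1) * f' x + f' x).
rewrite (_ : (fun x => f x / c) = fun x => (c^-1 - 1) * f x + f x).
  exact: is_weak_derivative_lin.
by apply/funext => x; ring.
Qed.

Lemma C0_Hs_near s T F t0 e : C0_Hs s T F -> (1 <= s)%N -> 0 <= t0 < T -> 0 < e ->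
  \forall t \near within (timeset T) (nbhs t0), forall x, `|F t x - F t0 x| < e.
Proof.
move=> [cF lF] s1 t0T e0.
have H := cvge0_lt (FF := within_filter _ (nbhs_filter t0)) (lF t0 t0T) e0.
apply: within_filterS H => t tT h x.
rewrite -lte_fin; apply: le_lt_trans h.
have [c1 _] := cF t tT; have [c2 _] := cF t0 t0T.
apply: (normr_le_Hs (f := fun x => F t x - F t0 x)) => //.
  by move=> y; apply: cvgB; [exact: c1|exact: c2].
move=> k k1; have ks := leq_trans k1 s1.
by apply: weakB; [exact: cont_Hs_weak (cF t tT) ks|exact: cont_Hs_weak (cF t0 t0T) ks].
Qed.

Lemma cont_Hs_derive s f x : cont_Hs s f -> (2 <= s)%N ->
  is_derive x 1 f (derive1 f x).
Proof.
move=> cs s2; have [g1 w1] := cont_Hs_weak cs (ltnW s2).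
have [g2 w2] := cont_Hs_weak cs s2.
by have [df _ _ _] := weak_derivative_C1 cs.1 w1 w2; exact: df.
Qed.

Lemma cont_Hs_derive_continuous s f : cont_Hs s f -> (2 <= s)%N ->
  continuous (derive1 f).
Proof.
move=> cs s2; have [g1 w1] := cont_Hs_weak cs (ltnW s2).
have [g2 w2] := cont_Hs_weak cs s2.
by have [] := weak_derivative_C1 cs.1 w1 w2.
Qed.

Lemma C0_Hs_near_derive s T F t0 e : C0_Hs s T F -> (2 <= s)%N ->
  0 <= t0 < T -> 0 < e ->
  \forall t \near within (timeset T) (nbhs t0),
    forall x, `|derive1 (F t) x - derive1 (F t0) x| < e.
Proof.
move=> [cF lF] s2 t0T e0.
have H := cvge0_lt (FF := within_filter _ (nbhs_filter t0)) (lF t0 t0T) e0.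
apply: within_filterS H => t tT h x.
rewrite -lte_fin; apply: le_lt_trans h.
have [c1 _] := cF t tT; have [c2 _] := cF t0 t0T.
have -> : derive1 (F t) x - derive1 (F t0) x = derive1 (fun x => F t x - F t0 x) x.
  apply/esym; apply: is_derive1E; apply: is_derive_sub.
    exact: cont_Hs_derive (cF t tT) s2.
  exact: cont_Hs_derive (cF t0 t0T) s2.
apply: (normr_derive1_le_Hs (f := fun x => F t x - F t0 x)) => //.
  by move=> y; apply: cvgB; [exact: c1|exact: c2].
move=> k k1; have ks := leq_trans k1 s2.
by apply: weakB; [exact: cont_Hs_weak (cF t tT) ks|exact: cont_Hs_weak (cF t0 t0T) ks].
Qed.

(* Freezing the time variable outside [0, T] turns one-sided continuity at the
   endpoints into continuity on the whole line. *)
Definition clamp T t : R := Num.min (Num.max t 0) T.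

Lemma clamp_id T t : 0 <= t <= T -> clamp T t = t.
Proof. by move=> /andP[t0 tT]; rewrite /clamp max_l// min_l. Qed.

Lemma clamp_range T t : 0 <= T -> 0 <= clamp T t <= T.
Proof. by move=> T0; rewrite /clamp le_min le_max lexx orbT T0 ge_min lexx orbT. Qed.

Lemma continuous_clamp T : continuous (clamp T).
Proof.
move=> t; apply: (@continuous_min _ _ (fun t => Num.max t 0) (cst T)).
  by apply: (@continuous_max _ _ id (cst 0)); [exact: cvg_id|exact: cvg_cst].
exact: cvg_cst.
Qed.

Definition jointly_continuous T F := continuous (fun z : R * R => F (clamp T z.1) z.2).

(** The increment splits into one in space at a fixed time and one in time at the moving point; the
    second is small because the hypothesis is uniform in [x]. *)
Lemma uniform_jointly_continuous T T' F : 0 <= T' < T ->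
  (forall t, 0 <= t < T -> continuous (F t)) ->
  (forall t0 e, 0 <= t0 < T -> 0 < e ->
    \forall t \near within (timeset T) (nbhs t0), forall x, `|F t x - F t0 x| < e) ->
  jointly_continuous T' F.
Proof.
move=> /andP[T0 TT] cF uF [t0 x0]; apply/cvgrPdist_lt => e e0.
have rng t : 0 <= clamp T' t < T.
  by have /andP[-> /le_lt_trans->] := clamp_range t T0.
have e2 : 0 < e / 2 by rewrite divr_gt0.
have /cvgrPdist_lt/(_ _ e2) cx := cF _ (rng t0) x0.
have ut : nbhs (clamp T' t0) (fun t => 0 <= t < T ->
    forall x, `|F t x - F (clamp T' t0) x| < e / 2) := uF _ _ (rng t0) e2.
have {ut} ct : nbhs t0 (fun t => 0 <= clamp T' t < T ->
    forall x, `|F (clamp T' t) x - F (clamp T' t0) x| < e / 2) := continuous_clamp ut.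
have zt : \forall z \near (t0, x0), forall x, `|F (clamp T' z.1) x - F (clamp T' t0) x| < e / 2.
  have : \forall z \near (t0, x0), 0 <= clamp T' z.1 < T ->
      forall x, `|F (clamp T' z.1) x - F (clamp T' t0) x| < e / 2.
    exact: (cvg_fst ct).
  by apply: filterS => z; apply.
have zx : \forall z \near (t0, x0), `|F (clamp T' t0) x0 - F (clamp T' t0) z.2| < e / 2.
  exact: (cvg_snd cx).
near=> z; rewrite /= [e]splitr.
have -> : F (clamp T' t0) x0 - F (clamp T' z.1) z.2 =
  (F (clamp T' t0) x0 - F (clamp T' t0) z.2) -
  (F (clamp T' z.1) z.2 - F (clamp T' t0) z.2) by ring.
rewrite (le_lt_trans (ler_normB _ _))// ltrD//; last by near: z; apply: filterS zt.
by near: z.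
Unshelve. all: end_near. Qed.

(** Convergence of the difference quotients in [H^s] is uniform in [x], hence pointwise. At an
    interior time [h + t] stays in the half-open time interval for small [h] of either sign. *)
Lemma C1_Hs_derive s T F : C1_Hs s T F -> (1 <= s)%N ->
  exists2 dF, C0_Hs s T dF &
    forall t x, 0 < t < T -> is_derive t 1 (F^~ x) (dF t x).
Proof.
move=> [[cF _] [dF [C0dF lF]]] s1; exists dF => // t x /andP[t0 tT].
have tT0 : 0 <= t < T by rewrite ltW.
suff L : h^-1 *: (F (h *: 1 + t) x - F t x) @[h --> 0^'] --> dF t x.
  apply: DeriveDef; first by apply/cvg_ex; exists (dF t x).
  exact/cvg_lim.
apply/cvgrPdist_lt => e e0.
have := cvge0_lt (FF := within_filter _ (dnbhs_filter t)) (lF t tT0) e0.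
move=> -[d /= d0 dP].
have tT' : 0 < T - t by rewrite subr_gt0.
near=> h.
have h0 : h != 0 by near: h; exact: nbhs_dnbhs_neq.
have hd : `|h| < d by near: h; exact: dnbhs0_lt.
have ht : `|h| < t by near: h; exact: dnbhs0_lt.
have hT : `|h| < T - t by near: h; exact: dnbhs0_lt.
have hT0 : 0 <= h + t < T by move: ht hT; rewrite !ltr_norml; lra.
have -> : h%:A = h by rewrite -[LHS]/(h * 1) mulr1.
have := dP (h + t); rewrite /ball/= opprD addrCA subrr addr0 normrN => /(_ hd).
have ne : h + t != t by rewrite -subr_eq0 addrK.
move=> /(_ ne hT0) Hn.
rewrite distrC -[_ *: _]/(_ * _) mulrC -lte_fin; apply: le_lt_trans Hn.
rewrite -{2}[h](addrK t).
apply: (normr_le_Hs (f := fun x => (F (h + t) x - F t x) / (h + t - t) - dF t x)) => //.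
  move=> y; apply: cvgB; last exact: ((C0dF.1 t tT0).1 y).
  apply: cvgM; last exact: cvg_cst.
  by apply: cvgB; [exact: (cF (h + t) hT0).1|exact: (cF t tT0).1].
move=> k k1; have ks := leq_trans k1 s1.
apply: weakB; last exact: cont_Hs_weak (C0dF.1 t tT0) ks.
apply: weakZ; apply: weakB; first exact: cont_Hs_weak (cF _ hT0) ks.
exact: cont_Hs_weak (cF _ tT0) ks.
Unshelve. all: end_near. Qed.

End TimeRegularity.

(** * Functions of class C^1 in time and space *)

Section C1Space.
Context {R : realType}.
Implicit Types (F G H Ft Fx Gt Gx : R -> R -> R) (a b c x y t T L : R) (s : nat).
Local Notation mu := (@lebesgue_measure R).

(** The derivatives are explicit arguments, so that the rules below compute them for compound
    expressions. [Ft] is a time derivative at interior times, but it is continuous up to [t = 0],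
    which bounds it on compact rectangles. *)
Definition C1_on T F Ft Fx : Prop :=
  [/\ forall t x, 0 <= t < T -> is_derive x 1 (F t) (Fx t x),
      forall t x, 0 < t < T -> is_derive t 1 (F^~ x) (Ft t x) &
      forall T', 0 <= T' < T ->
        [/\ jointly_continuous T' F, jointly_continuous T' Ft & jointly_continuous T' Fx]].

Lemma Hs_class_C1 s T F : (2 <= s)%N -> C0_Hs s T F -> C1_Hs s.-1 T F ->
  exists Ft, exists Fx, C1_on T F Ft Fx.
Proof.
move=> s2 C0F C1F; have s1 : (1 <= s.-1)%N by case: s s2 {C0F C1F} => [|[|]].
have [Ft C0Ft dF] := C1_Hs_derive C1F s1.
exists Ft, (fun t x => derive1 (F t) x); split => //.
  by move=> t x tT; exact: cont_Hs_derive (C0F.1 t tT) s2.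
move=> T' T'T; split; apply: (uniform_jointly_continuous T'T).
- by move=> t tT; exact: (C0F.1 t tT).1.
- by move=> t e tT e0; exact: C0_Hs_near C0F (ltnW s2) tT e0.
- by move=> t tT; exact: (C0Ft.1 t tT).1.
- by move=> t e tT e0; exact: C0_Hs_near C0Ft s1 tT e0.
- by move=> t tT; exact: cont_Hs_derive_continuous (C0F.1 t tT) s2.
- by move=> t e tT e0; exact: C0_Hs_near_derive C0F s2 tT e0.
Qed.

Lemma jc_cst T c : jointly_continuous T (fun _ _ => c).
Proof. by move=> z; exact: cvg_cst. Qed.

Lemma jcD T F G : jointly_continuous T F -> jointly_continuous T G ->
  jointly_continuous T (fun t x => F t x + G t x).
Proof. by move=> cF cG z; apply: cvgD; [exact: cF|exact: cG]. Qed.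

Lemma jcB T F G : jointly_continuous T F -> jointly_continuous T G ->
  jointly_continuous T (fun t x => F t x - G t x).
Proof. by move=> cF cG z; apply: cvgB; [exact: cF|exact: cG]. Qed.

Lemma jcM T F G : jointly_continuous T F -> jointly_continuous T G ->
  jointly_continuous T (fun t x => F t x * G t x).
Proof. by move=> cF cG z; apply: cvgM; [exact: cF|exact: cG]. Qed.

Lemma C1_on_cst T c : C1_on T (fun _ _ => c) (fun _ _ => 0) (fun _ _ => 0).
Proof.
split=> [t x _|t x _|T' _]; [exact: is_derive_cst|exact: is_derive_cst|].
by split; exact: jc_cst.
Qed.

Lemma C1_on_space T : C1_on T (fun _ x => x) (fun _ _ => 0) (fun _ _ => 1).
Proof.
split=> [t x _|t x _|T' _]; [exact: is_derive_id|exact: is_derive_cst|].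
by split; try exact: jc_cst; move=> z; exact: cvg_snd.
Qed.

Lemma C1_onD T F Ft Fx G Gt Gx : C1_on T F Ft Fx -> C1_on T G Gt Gx ->
  C1_on T (fun t x => F t x + G t x) (fun t x => Ft t x + Gt t x)
    (fun t x => Fx t x + Gx t x).
Proof.
move=> [Fx_ Ft_ Fc] [Gx_ Gt_ Gc]; split=> [t x tT|t x tT|T' T'T].
- by apply: is_derive_add; [exact: Fx_|exact: Gx_].
- by apply: is_derive_add; [exact: Ft_|exact: Gt_].
- have [? ? ?] := Fc _ T'T; have [? ? ?] := Gc _ T'T.
  by split; exact: jcD.
Qed.

Lemma C1_onB T F Ft Fx G Gt Gx : C1_on T F Ft Fx -> C1_on T G Gt Gx ->
  C1_on T (fun t x => F t x - G t x) (fun t x => Ft t x - Gt t x)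
    (fun t x => Fx t x - Gx t x).
Proof.
move=> [Fx_ Ft_ Fc] [Gx_ Gt_ Gc]; split=> [t x tT|t x tT|T' T'T].
- by apply: is_derive_sub; [exact: Fx_|exact: Gx_].
- by apply: is_derive_sub; [exact: Ft_|exact: Gt_].
- have [? ? ?] := Fc _ T'T; have [? ? ?] := Gc _ T'T.
  by split; exact: jcB.
Qed.

Lemma C1_onM T F Ft Fx G Gt Gx : C1_on T F Ft Fx -> C1_on T G Gt Gx ->
  C1_on T (fun t x => F t x * G t x) (fun t x => F t x * Gt t x + G t x * Ft t x)
    (fun t x => F t x * Gx t x + G t x * Fx t x).
Proof.
move=> [Fx_ Ft_ Fc] [Gx_ Gt_ Gc]; split=> [t x tT|t x tT|T' T'T].
- by apply: is_derive_mul; [exact: Fx_|exact: Gx_].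
- by apply: (@is_derive_mul _ (F^~ x) (G^~ x)); [exact: Ft_|exact: Gt_].
- have [? ? ?] := Fc _ T'T; have [? ? ?] := Gc _ T'T.
  by split; [exact: jcM|apply: jcD; exact: jcM|apply: jcD; exact: jcM].
Qed.

(** Brings in the constitutive functions, the inverse and the logarithm, whose regularity is used on
    positive arguments. *)
Lemma C1_on_comp T (phi dphi : R -> R) F Ft Fx :
  (forall y, 0 < y -> is_derive y 1 phi (dphi y)) ->
  (forall y, 0 < y -> {for y, continuous dphi}) ->
  (forall t x, 0 <= t < T -> 0 < F t x) ->
  C1_on T F Ft Fx ->
  C1_on T (fun t x => phi (F t x)) (fun t x => dphi (F t x) * Ft t x)
    (fun t x => dphi (F t x) * Fx t x).
Proof.
move=> dp cdp F0 [Fx_ Ft_ Fc]; split=> [t x tT|t x tT|T' T'T].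
- by apply: (@is_derive_chain _ (F t)); [apply: dp; exact: F0|exact: Fx_].
- apply: (@is_derive_chain _ (F^~ x)); last exact: Ft_.
  by apply: dp; apply: F0; case/andP: tT => /ltW -> ->.
- have [cF cFt cFx] := Fc _ T'T.
  have pos z : 0 < F (clamp T' z.1) z.2.
    case/andP: T'T => T0 TT; apply: F0.
    by have /andP[-> /le_lt_trans->] := clamp_range z.1 T0.
  have cp : jointly_continuous T' (fun t x => phi (F t x)).
    move=> z; apply: continuous_comp (cF z) _.
    exact: is_derive_continuous (dp _ (pos z)).
  have cdpF : jointly_continuous T' (fun t x => dphi (F t x)).
    by move=> z; apply: continuous_comp (cF z) _; exact: cdp (pos z).
  by split => //; exact: jcM.
Qed.

Lemma jc_slice T t F : jointly_continuous T F -> 0 <= t <= T -> continuous (F t).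
Proof.
move=> cF tT x.
have c2 : {for x, continuous (fun y : R => (t, y))}.
  apply: (@cvg_pair _ _ _ (nbhs x) (nbhs t) (nbhs x) _ _ _ (fun=> t) id).
    exact: cvg_cst.
  exact: cvg_id.
have := continuous_comp c2 (cF (t, x)).
by rewrite /comp /= clamp_id.
Qed.

Lemma jc_bounded T F a b : 0 <= T -> jointly_continuous T F ->
  exists2 B, 0 <= B & forall t x, 0 <= t <= T -> a <= x <= b -> `|F t x| <= B.
Proof.
move=> T0 cF.
have cK : compact (`[0, T]%classic `*` `[a, b]%classic : set (R * R)).
  by apply: compact_setX; exact: segment_compact.
have := continuous_compact (continuous_subspaceT cF) cK.
move=> /compact_bounded[N [_ NP]].
have N1 : N < `|N| + 1 by rewrite ltr_pwDr// ler_norm.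
exists (`|N| + 1) => [|t x tT xab]; first exact: addr_ge0.
apply: (NP _ N1); exists (t, x); first by split; rewrite /= in_itv.
by rewrite /= clamp_id.
Qed.

End C1Space.

(** * Integral balance laws *)

Section Balance.
Context {R : realType}.
Implicit Types (g h gt gx ht hx : R -> R -> R) (a b c x y t T L : R) (s : nat).
Local Notation mu := (@lebesgue_measure R).

Lemma C1_on_slice T g gt gx t : C1_on T g gt gx -> 0 <= t < T ->
  [/\ continuous (g t), continuous (gt t) & continuous (gx t)].
Proof.
move=> [_ _ gc] /andP[t0 tT]; have [|c1 c2 c3] := gc t; first by rewrite t0.
by split; [apply: jc_slice c1 _|apply: jc_slice c2 _|apply: jc_slice c3 _]; rewrite t0 lexx.
Qed.

(** Mean value theorem in time, with a bound of [gt] on a compact rectangle. *)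
Lemma C1_on_lipschitz T T' L g gt gx : C1_on T g gt gx -> 0 <= T' < T ->
  exists2 B, 0 <= B & forall t1 t2 x, 0 <= t1 <= T' -> 0 <= t2 <= T' -> - L <= x <= L ->
    `|g t2 x - g t1 x| <= B * `|t2 - t1|.
Proof.
move=> [_ dg gc] /[dup] T'T /andP[T'0 TT].
have [cg cgt _] := gc _ T'T.
have [B B0 BP] := jc_bounded (- L) L T'0 cgt.
exists B => // t1 t2 x.
wlog le12 : t1 t2 / t1 <= t2 => [W t1T t2T xL|].
  have [le12|/ltW le21] := leP t1 t2; first exact: W.
  by rewrite distrC [`|t2 - _|]distrC; exact: W.
move=> /andP[t10 t1T] /andP[t20 t2T] xL.
have in0 t : t \in `]t1, t2[%R -> 0 < t < T'.
  by rewrite in_itv/= => /andP[a1 a2]; rewrite (le_lt_trans t10 a1) (lt_le_trans a2 t2T).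
(* Continuity of [g] in time up to the endpoints is available in clamped form, so the theorem is
   applied to the clamped function. *)
have [t tt|t|t tt] := @MVT_segment R (fun t => g (clamp T' t) x) (fun t => gt t x) t1 t2 le12.
- apply: (@near_eq_is_derive _ _ _ (g^~ x)); last first.
    by apply: dg; have /andP[-> /lt_trans->] := in0 _ tt.
  near=> y; rewrite clamp_id//; apply/andP; split; apply: ltW; near: y.
    by apply: lt_nbhsr; have /andP[] := in0 _ tt.
  by apply: lt_nbhsl; have /andP[] := in0 _ tt.
- apply: continuous_subspaceT => y.
  have c2 : {for y, continuous (fun t : R => (t, x))}.
    apply: (@cvg_pair _ _ _ (nbhs y) (nbhs y) (nbhs x) _ _ _ id (fun=> x)).
      exact: cvg_id.
    exact: cvg_cst.
  exact: (continuous_comp c2 (cg (y, x))).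
- rewrite !clamp_id ?t10 ?t20 ?t1T ?t2T// => ->.
  rewrite normrM ler_wpM2r// BP//; move: tt; rewrite in_itv/= => /andP[tt1 tt2].
  by rewrite (le_trans t10 tt1) (le_trans tt2 t2T).
Unshelve. all: end_near. Qed.

(** The integral is Lipschitz in time. This reaches [t = 0], where [C1_on] provides no time
    derivative. *)
Lemma balance_continuous T T' L g gt gx : C1_on T g gt gx -> 0 <= T' < T -> 0 <= L ->
  {within `[0, T'], continuous (fun t => \int[mu]_(x in `[- L, L]) g t x)}.
Proof.
move=> cg T'T L0; have [B B0 BP] := C1_on_lipschitz L cg T'T.
have ig t : 0 <= t <= T' -> mu.-integrable `[- L, L] (EFin \o g t).
  move=> /andP[t0 tT]; apply: continuous_integrable_seg.
  have [|//] := C1_on_slice cg (t := t).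
  by rewrite t0 (le_lt_trans tT)//; case/andP: T'T.
have mL : fine (mu `[- L, L]) = L + L.
  rewrite lebesgue_measure_itv/= lte_fin; case: ifPn => [_|].
    by rewrite -EFinB/= opprK.
  by rewrite -leNgt => L1 /=; lra.
have key t1 t2 : 0 <= t1 <= T' -> 0 <= t2 <= T' ->
    `|\int[mu]_(x in `[- L, L]) g t2 x - \int[mu]_(x in `[- L, L]) g t1 x| <=
    B * (L + L) * `|t2 - t1|.
  move=> t1T t2T; have i1 := ig _ t1T; have i2 := ig _ t2T.
  have i12 := integrable_segB i2 i1.
  rewrite -RintegralB// (le_trans (le_normr_Rintegral _ _))//.
  rewrite [leRHS](_ : _ = \int[mu]_(x in `[- L, L]) (B * `|t2 - t1|)); last first.
    by rewrite Rintegral_cst// mL; ring.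
  apply: le_Rintegral => //.
  - exact: integrable_norm i12.
  - by apply: continuous_integrable_seg => z; exact: cvg_cst.
  - by move=> x /=; rewrite in_itv/=; exact: BP.
apply/subspace_continuousP => t0 /= t0T; rewrite in_itv/= in t0T.
apply/cvgrPdist_le => e e0.
(* Adding 1 keeps the divisor positive when [B] or [L] is 0. *)
have K0 : 0 < B * (L + L) + 1 by rewrite ltr_wpDl// mulr_ge0// addr_ge0.
have d0 : 0 < e / (B * (L + L) + 1) by rewrite divr_gt0.
exists (e / (B * (L + L) + 1)) => //= t; rewrite /ball/= => td; rewrite in_itv/= => tT.
rewrite (le_trans (key _ _ tT t0T))//.
rewrite (@le_trans _ _ ((B * (L + L) + 1) * `|t0 - t|))// ?ler_wpM2r ?lerDl//.
by rewrite -ler_pdivlMl// mulrC ltW.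
Qed.

(** Differentiation under the integral sign, dominated by a bound of [gt] on a rectangle. The
    integral of [hx] is 0 because the boundary fluxes agree; it is added so that a conservation law
    can replace the integrand by its source. *)
Lemma balance_derive T T' L g gt gx h ht hx t : C1_on T g gt gx -> C1_on T h ht hx ->
  0 < T' < T -> 0 <= L -> 0 < t < T' -> h t L = h t (- L) ->
  is_derive t 1 (fun t => \int[mu]_(x in `[- L, L]) g t x)
    (\int[mu]_(x in `[- L, L]) (gt t x + hx t x)).
Proof.
move=> cg ch /andP[T'0 TT] L0 tT hL.
have T'T : 0 <= T' < T by rewrite ltW.
have [_ dg gc] := cg; have [dh _ _] := ch.
have [_ cgt _] := gc _ T'T.
have [B B0 BP] := jc_bounded (- L) L (ltW T'0) cgt.
have tT0 : 0 <= t < T by case/andP: tT => t0 tT; rewrite ltW// (lt_trans tT).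
have dgx y x : `]0, T'[%classic y -> is_derive y 1 (g^~ x) (gt y x).
  by rewrite /= in_itv/= => /andP[y0 yT]; apply: dg; rewrite y0 (lt_trans yT).
have Ia : `]0, T'[%classic t by rewrite /= in_itv/=.
have intg y : `]0, T'[%classic y -> mu.-integrable `[- L, L] (EFin \o g y).
  rewrite /= in_itv/= => /andP[y0 yT]; apply: continuous_integrable_seg.
  by have [|//] := C1_on_slice cg (t := y); rewrite ltW// (lt_trans yT).
have intB : mu.-integrable `[- L, L] (EFin \o (fun=> B)).
  by apply: continuous_integrable_seg => z; exact: cvg_cst.
have derg y x : `]0, T'[%classic y -> `[- L, L]%classic x -> derivable (g^~ x) y 1.
  by move=> yI _; have [] := dgx _ x yI.
have ub y x : `]0, T'[%classic y -> `[- L, L]%classic x -> `|partial1of2 g y x| <= B.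
  move=> yI /=; rewrite in_itv/= => xL.
  rewrite /partial1of2 (is_derive1E (dgx _ x yI)); apply: BP => //.
  by move: yI; rewrite /= in_itv/= => /andP[/ltW -> /ltW ->].
have mI : measurable (`[- L, L]%classic : set (measurableTypeR R)) by exact: measurable_itv.
have ID := derivable_under_integral mI Ia intg derg (fun=> B0) intB ub.
have IE := differentiation_under_integral mI Ia intg derg (fun=> B0) intB ub.
have [_ c2 _] := C1_on_slice cg tT0; have [_ _ c3] := C1_on_slice ch tT0.
rewrite RintegralD//; try exact: continuous_integrable_seg.
rewrite (Rintegral_FTC _ c3 (fun x => dh t x tT0)); last by rewrite ge0_cp.
rewrite hL subrr addr0.
have -> : \int[mu]_(x in `[- L, L]) gt t x = derive1 (fun t => \int[mu]_(x in `[- L, L]) g t x) t.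
  rewrite IE; apply: eq_Rintegral => x _.
  by rewrite /partial1of2 (is_derive1E (dgx _ x Ia)).
exact: derivable_is_derive1.
Qed.

End Balance.

(** * The conservation laws of the system *)

Section Constitutive.
Context {R : realType}.
Implicit Types (f g : R -> R) (x y : R).

Lemma cont_id y : {for y, continuous (fun z : R => z)}.
Proof. exact: cvg_id. Qed.

Lemma cont_cst (c y : R) : {for y, continuous (fun=> c)}.
Proof. exact: cvg_cst. Qed.

Lemma contD f g y : {for y, continuous f} -> {for y, continuous g} ->
  {for y, continuous (fun z => f z + g z)}.
Proof. exact: continuousD. Qed.

Lemma contB f g y : {for y, continuous f} -> {for y, continuous g} ->
  {for y, continuous (fun z => f z - g z)}.
Proof. exact: continuousB. Qed.

Lemma contM f g y : {for y, continuous f} -> {for y, continuous g} ->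
  {for y, continuous (fun z => f z * g z)}.
Proof. exact: continuousM. Qed.

Lemma contV f y : f y != 0 -> {for y, continuous f} ->
  {for y, continuous (fun z => (f z)^-1)}.
Proof. by move=> f0 cf; exact: cvgV. Qed.

Lemma near_gt0 (P : R -> Prop) y : (forall z, 0 < z -> P z) -> 0 < y ->
  \forall z \near y, P z.
Proof.
move=> Pz y0; near=> z; apply: Pz; near: z; exact: lt_nbhsr.
Unshelve. all: end_near. Qed.

Lemma is_derive_quotient f g y (df dg : R) : g y != 0 ->
  is_derive y 1 f df -> is_derive y 1 g dg ->
  is_derive y 1 (fun z => f z / g z) ((df * g y - f y * dg) / g y ^+ 2).
Proof.
move=> g0 fd gd; apply: is_derive_eq (is_derive_mul fd (is_derive_inv g0 gd)) _.
by rewrite /=; field.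
Qed.

Lemma smooth_on_posP f : smooth_on_pos f -> exists f1 f2 : R -> R,
  forall y, 0 < y -> [/\ is_derive y 1 f (f1 y), is_derive y 1 f1 (f2 y) &
    {for y, continuous f2}].
Proof.
move=> sf; exists (derive1 f), (derive1 (derive1 f)) => y y0; split.
- by apply: derivable_is_derive1; exact: (sf 0%N).
- by apply: derivable_is_derive1; exact: (sf 1%N).
- exact: is_derive_continuous (derivable_is_derive1 (sf 2%N y y0)).
Qed.

Section Z.
Context (tau1 kappa : R -> R).
Context (tau1_smooth : smooth_on_pos tau1) (kappa_smooth : smooth_on_pos kappa)
  (kappa_gt0 : forall th : R, 0 < th -> 0 < kappa th).
Let Z := Zfun tau1 kappa.

(** [afun] involves the derivative of [Z], so its own derivative, which enters the energy law,
    requires two derivatives of [Z]. *)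
Lemma Zfun_regular : exists Z1 Z2 : R -> R,
  forall y, 0 < y -> [/\ is_derive y 1 Z (Z1 y), is_derive y 1 Z1 (Z2 y) &
    {for y, continuous Z2}].
Proof.
have [t1 [t2 tP]] := smooth_on_posP tau1_smooth.
have [k1 [k2 kP]] := smooth_on_posP kappa_smooth.
pose N y := t1 y * kappa y - tau1 y * k1 y.
exists (fun y => N y / (kappa y * kappa y)).
exists (fun y => ((t2 y * kappa y - tau1 y * k2 y) * (kappa y * kappa y)
    - N y * (kappa y * k1 y + kappa y * k1 y)) / (kappa y * kappa y) ^+ 2) => y y0.
have [dt dt1 ct2] := tP y y0; have [dk dk1 ck2] := kP y y0.
have k0 : kappa y != 0 by rewrite gt_eqF// kappa_gt0.
have ct := is_derive_continuous dt; have ct1 := is_derive_continuous dt1.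
have ck := is_derive_continuous dk; have ck1 := is_derive_continuous dk1.
have kk0 : kappa y * kappa y != 0 by rewrite mulf_neq0.
split.
- by apply: is_derive_eq (is_derive_quotient k0 dt dk) _; rewrite expr2.
- have dN : is_derive y 1 N _ := is_derive_sub (is_derive_mul dt1 dk) (is_derive_mul dt dk1).
  apply: is_derive_eq (@is_derive_quotient N (fun y => kappa y * kappa y) _ _ _
    kk0 dN (is_derive_mul dk dk)) _.
  by congr (_ / _); rewrite /N; ring.
- have ckk := contM ck ck.
  apply: contM; last first.
    by apply: contV; [rewrite expf_neq0|exact: (contM ckk ckk)].
  apply: contB; first by apply: contM => //; apply: contB; exact: contM.
  by apply: contM; [apply: contB; exact: contM|apply: contD; exact: contM].
Qed.

(** Values and derivatives are expressed through [Z], [Z1] and [Z2], the form in which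
    [entropy_production] receives them. *)
Lemma afun_regular : exists Z1 Z2 : R -> R, forall y, 0 < y ->
  [/\ afun tau1 kappa y = Z y / y - 2^-1 * Z1 y,
      half_dZ_over tau1 kappa y = 2^-1 * ((Z1 y * y - Z y) / y ^+ 2),
      is_derive y 1 (afun tau1 kappa) ((Z1 y * y - Z y) / y ^+ 2 - 2^-1 * Z2 y) /\
      {for y, continuous (fun y => (Z1 y * y - Z y) / y ^+ 2 - 2^-1 * Z2 y)} &
      is_derive y 1 (half_dZ_over tau1 kappa)
        (2^-1 * ((Z2 y * y ^+ 2 - 2 * (Z1 y * y - Z y)) / y ^+ 3)) /\
      {for y, continuous (fun y => 2^-1 * ((Z2 y * y ^+ 2 - 2 * (Z1 y * y - Z y)) / y ^+ 3))}].
Proof.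
have [Z1 [Z2 ZP]] := Zfun_regular; exists Z1, Z2.
have aE y : 0 < y -> afun tau1 kappa y = Z y / y - 2^-1 * Z1 y.
  by move=> y0; have [dZ _ _] := ZP y y0; rewrite /afun (is_derive1E dZ).
have dQ y : 0 < y -> is_derive y 1 (fun y => Z y / y) ((Z1 y * y - Z y) / y ^+ 2).
  move=> y0; have [dZ _ _] := ZP y y0.
  apply: is_derive_eq (@is_derive_quotient _ id _ _ _ (lt0r_neq0 y0) dZ
    (is_derive_id y 1)) _.
  by rewrite mulr1.
have bE y : 0 < y -> half_dZ_over tau1 kappa y = 2^-1 * ((Z1 y * y - Z y) / y ^+ 2).
  by move=> y0; rewrite /half_dZ_over (is_derive1E (dQ y y0)).
move=> y y0; have [dZ dZ1 cZ2] := ZP y y0.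
have yn0 := lt0r_neq0 y0.
have cZ := is_derive_continuous dZ; have cZ1 := is_derive_continuous dZ1.
have cy2 : {for y, continuous (fun z : R => z ^+ 2)} := contM (@cont_id y) (@cont_id y).
have cy3 : {for y, continuous (fun z : R => z ^+ 3)} := contM (@cont_id y) cy2.
have y2 : y ^+ 2 != 0 by rewrite expf_neq0.
have y3 : y ^+ 3 != 0 by rewrite expf_neq0.
have cN : {for y, continuous (fun y => Z1 y * y - Z y)}.
  by apply: contB => //; apply: contM => //; exact: cont_id.
split; [exact: aE|exact: bE| |]; split.
- apply: (@near_eq_is_derive _ _ _ (fun y => Z y / y - 2^-1 * Z1 y)).
    by apply: near_gt0 y0 => z z0; rewrite aE.
  exact: is_derive_sub (dQ y y0) (is_derive_scale 2^-1 dZ1).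
- apply: contB; first by apply: contM => //; exact: contV.
  by apply: contM => //; exact: cont_cst.
- apply: (@near_eq_is_derive _ _ _ (fun y => 2^-1 * ((Z1 y * y - Z y) / y ^+ 2))).
    by apply: near_gt0 y0 => z z0; rewrite bE.
  have dN := is_derive_sub (is_derive_mul dZ1 (is_derive_id y 1)) dZ.
  apply: is_derive_eq (is_derive_scale 2^-1
    (@is_derive_quotient _ (fun y => y ^+ 2) _ _ _ y2 dN (is_derive_exp 2 (is_derive_id y 1)))) _.
  by rewrite /=; field.
- apply: contM; first exact: cont_cst.
  apply: contM; last exact: contV.
  apply: contB; first exact: contM.
  by apply: contM => //; exact: cont_cst.
Qed.

End Z.
End Constitutive.

(** * Entropy production *)

Section Entropy.
Context {R : realType}.

(* The five hypotheses are the equations of the system at a point; [r * en] is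
   the total energy density and [r * eta] the entropy density. *)
Lemma entropy_production (r rt rx u ut ux th tht thx q qt qx S St Sx tau1 kappa
    Z1 Z2 tau2 mu Cv Rg lr lth : R) :
  r != 0 -> th != 0 -> kappa != 0 -> mu != 0 ->
  let Z := tau1 / kappa in
  let a := Z / th - 2^-1 * Z1 in
  let da := (Z1 * th - Z) / th ^+ 2 - 2^-1 * Z2 in
  let b := 2^-1 * ((Z1 * th - Z) / th ^+ 2) in
  let db := 2^-1 * ((Z2 * th ^+ 2 - 2 * (Z1 * th - Z)) / th ^+ 3) in
  let en := 2^-1 * u ^+ 2 + tau2 / (2 * mu) * S ^+ 2 + (Cv * th + a * q ^+ 2) in
  let ent := u * ut + tau2 / mu * S * St + (Cv * tht + da * tht * q ^+ 2 + 2 * a * q * qt) in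
  let enx := u * ux + tau2 / mu * S * Sx + (Cv * thx + da * thx * q ^+ 2 + 2 * a * q * qx) in
  let eta := Cv * lth - Rg * lr - b * q ^+ 2 in
  let etat := Cv * (tht / th) - Rg * (rt / r) - (db * tht * q ^+ 2 + 2 * b * q * qt) in
  let etax := Cv * (thx / th) - Rg * (rx / r) - (db * thx * q ^+ 2 + 2 * b * q * qx) in
  rt + (r * ux + u * rx) = 0 ->
  r * ut + r * u * ux + Rg * (r * thx + th * rx) - Sx = 0 ->
  (rt * en + r * ent) + (ux * (r * en) + u * (rx * en + r * enx))
    + Rg * (ux * r * th + u * rx * th + u * r * thx) + qx - (Sx * u + S * ux) = 0 ->
  tau1 * (r * qt + r * u * qx) + q + kappa * thx = 0 ->
  tau2 * (r * St + r * u * Sx) + S - mu * ux = 0 ->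
  (rt * eta + r * etat) + (ux * (r * eta) + u * (rx * eta + r * etax))
    + (qx / th - q * thx / th ^+ 2) = S ^+ 2 / (mu * th) + q ^+ 2 / (kappa * th ^+ 2).
Proof.
move=> r0 th0 k0 mu0 Z a da b db en ent enx eta etat etax.
move=> E1 E2 E3 E4 E5; apply/eqP; rewrite -subr_eq0; apply/eqP.
(* The multipliers are those of the Gibbs relation: [th^-1] on the energy law, the others to match
   the time derivatives of [r], [u], [q] and [S]. The terms in [q] match because
   [2 * a / th + 2 * b = Z / th ^+ 2] and [da + th * db = 0]. *)
have lin e1 e2 e3 e4 e5 : e1 = 0 -> e2 = 0 -> e3 = 0 -> e4 = 0 -> e5 = 0 ->
    (eta - Rg - en / th) * e1 - u / th * e2 + e3 / th
      - q / (kappa * th ^+ 2) * e4 - S / (mu * th) * e5 = 0.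
  by move=> -> -> -> -> ->; rewrite !mulr0 mul0r !addr0 !subr0.
apply: etrans (lin _ _ _ _ _ E1 E2 E3 E4 E5).
rewrite /etat /etax /eta /ent /enx /en /db /b /da /a /Z.
by field; rewrite r0 th0 k0 mu0.
Qed.

End Entropy.

Section NavierStokes.
Context {R : realType}.
Implicit Types (F g h r Ft Fx : R -> R -> R) (x t T L : R).
Local Notation mu_ := (@lebesgue_measure R).

Lemma C1_on_subK T F Ft Fx c : C1_on T (fun t x => F t x - c) Ft Fx -> C1_on T F Ft Fx.
Proof.
move=> /C1_onD/(_ (C1_on_cst T c)) cF.
have E (G : R -> R -> R) : (fun t x => G t x + 0) = G.
  by apply/funext => t; apply/funext => x; rewrite addr0.
have EF : (fun t x => F t x - c + c) = F.
  by apply/funext => t; apply/funext => x; rewrite subrK.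
by rewrite EF !E in cF.
Qed.

Lemma C1_onX2 T F Ft Fx : C1_on T F Ft Fx ->
  C1_on T (fun t x => F t x ^+ 2) (fun t x => F t x * Ft t x + F t x * Ft t x)
    (fun t x => F t x * Fx t x + F t x * Fx t x).
Proof. by move=> cF; exact: (C1_onM cF cF). Qed.

Lemma C1_on_inv T F Ft Fx : (forall t x, 0 <= t < T -> 0 < F t x) -> C1_on T F Ft Fx ->
  C1_on T (fun t x => (F t x)^-1) (fun t x => - (F t x) ^- 2 * Ft t x)
    (fun t x => - (F t x) ^- 2 * Fx t x).
Proof.
apply: (@C1_on_comp _ T GRing.inv (fun y => - y ^- 2)) => y y0.
  by have := is_derive_inv (f := id) (lt0r_neq0 y0) (is_derive_id y 1); rewrite mulr1.
have c2 : {for y, continuous (fun z : R => (z ^+ 2)^-1)}.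
  apply: (@contV _ (fun z => z ^+ 2)); first by rewrite expf_neq0// gt_eqF.
  exact: contM (@cont_id _ y) (@cont_id _ y).
exact: cvgN c2.
Qed.

Lemma C1_on_ln T F Ft Fx : (forall t x, 0 <= t < T -> 0 < F t x) -> C1_on T F Ft Fx ->
  C1_on T (fun t x => ln (F t x)) (fun t x => (F t x)^-1 * Ft t x)
    (fun t x => (F t x)^-1 * Fx t x).
Proof.
apply: (@C1_on_comp _ T (@ln R) GRing.inv) => y y0.
by apply: inv_continuous; rewrite gt_eqF.
Qed.

Lemma C1_on_dt T F Ft Fx t x : C1_on T F Ft Fx -> 0 < t < T ->
  derive1 (fun t' => F t' x) t = Ft t x.
Proof. by move=> [_ cF _] tT; exact: is_derive1E (cF t x tT). Qed.

Lemma C1_on_dx T F Ft Fx t x : C1_on T F Ft Fx -> 0 < t < T ->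
  derive1 (F t) x = Fx t x.
Proof.
move=> [cF _ _] /andP[/ltW t0 tT]; apply: is_derive1E; apply: cF.
by rewrite t0.
Qed.

(** [g] is the density, [h] the flux and [r] the source. The derivatives are existential because
    they are long compound expressions, left to unification. *)
Definition conservation_law T g h r := exists gt gx ht hx,
  [/\ C1_on T g gt gx, C1_on T h ht hx &
      forall t x, 0 < t < T -> gt t x + hx t x = r t x].

Lemma conservation_lawP T T' L g h r : conservation_law T g h r ->
  0 < T' < T -> 0 <= L -> (forall t, 0 < t < T' -> h t L = h t (- L)) ->
  {within `[0, T'], continuous (fun t => \int[mu_]_(x in `[- L, L]) g t x)} /\
  forall t, 0 < t < T' -> is_derive t 1 (fun t => \int[mu_]_(x in `[- L, L]) g t x)
    (\int[mu_]_(x in `[- L, L]) r t x).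
Proof.
move=> [gt [gx [ht [hx [cg ch ghr]]]]] /[dup] T'T /andP[T'0 TT] L0 hL; split.
  by apply: (balance_continuous cg) => //; rewrite ltW.
move=> t tT; apply: is_derive_eq (balance_derive cg ch T'T L0 tT (hL t tT)) _.
apply: eq_Rintegral => x _; apply: ghr.
by case/andP: tT => -> /lt_trans->.
Qed.

Context (tau2 mu Cv Rgas : R) (tau1 kappa : R -> R).
Context (mu_gt0 : 0 < mu).
Context (tau1_smooth : smooth_on_pos tau1) (kappa_smooth : smooth_on_pos kappa).
Context (kappa_gt0 : forall th : R, 0 < th -> 0 < kappa th).
Let P := Gas tau2 mu Cv Rgas tau1 kappa.
Context (s : nat) (T : R) (U0 : state R) (U : R -> state R).
Context (s2 : (2 <= s)%N) (solU : smooth_solution P s T U0 U).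

Let r t x := density (U t) x.
Let u t x := velocity (U t) x.
Let th t x := temperature (U t) x.
Let q t x := heatflux (U t) x.
Let S t x := stress (U t) x.

(** Entropy of the relaxed gas, normalised to vanish in the rest state. The coefficient of the heat
    flux term is the one for which the production is a sum of weighted squares. *)
Definition specific_entropy W x : R :=
  Cv * ln (temperature W x) - Rgas * ln (density W x)
  - half_dZ_over tau1 kappa (temperature W x) * heatflux W x ^+ 2.

Let r_gt0 t x : 0 <= t < T -> 0 < r t x.
Proof. by case: solU => _ _ + _ => /[apply] /(_ x) []. Qed.

Let th_gt0 t x : 0 <= t < T -> 0 < th t x.
Proof. by case: solU => _ _ + _ => /[apply] /(_ x) []. Qed.

(** Mass, energy, entropy and virial. In the last law, moving [x] inside the space derivative of the
    momentum flux leaves the source [- S]. The stress equation expresses [S] through the balance of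
    [tau2 * (r * S)] and the derivative of [mu * u]; this is why [F] carries a stress correction.
    Subtracting [Rgas] makes the flux vanish in the rest state, as it must, since the weight [x]
    differs at the two ends. *)
Lemma NS_conservation_laws :
  [/\ conservation_law T r (fun t x => u t x * r t x) (fun _ _ => 0),
      conservation_law T (fun t x => energy P (U t) x)
        (fun t x => u t x * energy P (U t) x + pressure P (U t) x * u t x + q t x
          - S t x * u t x) (fun _ _ => 0),
      conservation_law T (fun t x => r t x * specific_entropy (U t) x)
        (fun t x => u t x * (r t x * specific_entropy (U t) x) + q t x / th t x)
        (fun t x => S t x ^+ 2 / (mu * th t x)
          + q t x ^+ 2 / (kappa (th t x) * th t x ^+ 2)) &
      conservation_law T (fun t x => r t x * u t x * x - tau2 * (r t x * S t x))
        (fun t x => x * (u t x * (r t x * u t x) + pressure P (U t) x - Rgas - S t x)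
          - tau2 * (u t x * (r t x * S t x)) + mu * u t x)
        (fun t x => r t x * u t x ^+ 2 + pressure P (U t) x - Rgas)].
Proof.
have [_ [kr ku kth kq kS] _ NS] := solU.
have [rt [rx /C1_on_subK cr]] := Hs_class_C1 s2 kr.1 kr.2.
have [ut [ux cu]] := Hs_class_C1 s2 ku.1 ku.2.
have [tht [thx /C1_on_subK cth]] := Hs_class_C1 s2 kth.1 kth.2.
have [qt [qx cq]] := Hs_class_C1 s2 kq.1 kq.2.
have [St [Sx cS]] := Hs_class_C1 s2 kS.1 kS.2.
have [Z1 [Z2 ZP]] := afun_regular tau1_smooth kappa_smooth kappa_gt0.
pose Z := Zfun tau1 kappa.
pose da y := (Z1 y * y - Z y) / y ^+ 2 - 2^-1 * Z2 y.
pose db y := 2^-1 * ((Z2 y * y ^+ 2 - 2 * (Z1 y * y - Z y)) / y ^+ 3).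
have ca := @C1_on_comp _ T (afun tau1 kappa) da _ _ _
  (fun y y0 => let: And4 _ _ H _ := ZP y y0 in H.1)
  (fun y y0 => let: And4 _ _ H _ := ZP y y0 in H.2) th_gt0 cth.
have cb := @C1_on_comp _ T (half_dZ_over tau1 kappa) db _ _ _
  (fun y y0 => let: And4 _ _ _ H := ZP y y0 in H.1)
  (fun y y0 => let: And4 _ _ _ H := ZP y y0 in H.2) th_gt0 cth.
have cinv := C1_on_inv th_gt0 cth.
have clnth := C1_on_ln th_gt0 cth.
have clnr := C1_on_ln r_gt0 cr.
have cE := C1_onD (C1_onD (C1_onM (C1_onM (C1_on_cst T 2^-1) cr) (C1_onX2 cu))
  (C1_onM (C1_onM (C1_on_cst T (tau2 / (2 * mu))) cr) (C1_onX2 cS)))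
  (C1_onM cr (C1_onD (C1_onM (C1_on_cst T Cv) cth) (C1_onM ca (C1_onX2 cq)))).
have cp := C1_onM (C1_onM (C1_on_cst T Rgas) cr) cth.
have cH := C1_onB (C1_onD (C1_onD (C1_onM cu cE) (C1_onM cp cu)) cq) (C1_onM cS cu).
have eqs t x : 0 < t < T ->
  [/\ rt t x + (r t x * ux t x + u t x * rx t x) = 0,
      r t x * ut t x + r t x * u t x * ux t x
        + Rgas * (r t x * thx t x + th t x * rx t x) - Sx t x = 0,
      tau1 (th t x) * (r t x * qt t x + r t x * u t x * qx t x) + q t x
        + kappa (th t x) * thx t x = 0 &
      tau2 * (r t x * St t x + r t x * u t x * Sx t x) + S t x - mu * ux t x = 0].
  move=> tT; have [e1 e2 _ e4 e5] := NS t x tT.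
  rewrite (C1_on_dt x cr tT) (C1_on_dx x (C1_onM cr cu) tT) in e1.
  rewrite (C1_on_dt x cu tT) (C1_on_dx x cu tT) (C1_on_dx x cS tT) (C1_on_dx x cp tT) in e2.
  rewrite (C1_on_dt x cq tT) (C1_on_dx x cq tT) (C1_on_dx x cth tT) in e4.
  rewrite (C1_on_dt x cS tT) (C1_on_dx x cS tT) (C1_on_dx x cu tT) in e5.
  split => //; last by rewrite e5 subrr.
  by rewrite -[Sx t x]e2 /r /u /th; ring.
split.
- exists rt, rx; do 2 eexists; split; [exact: cr|exact: (C1_onM cu cr)|].
  by move=> t x tT; have [e1 _ _ _] := eqs t x tT; rewrite -[RHS]e1 /r /u; ring.
- do 4 eexists; split; [exact: cE|exact: cH|].
  move=> t x tT; have [_ _ e3 _ _] := NS t x tT.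
  by rewrite (C1_on_dt x cE tT) (C1_on_dx x cH tT) in e3.
- have cC := C1_on_cst T Cv; have cRg := C1_on_cst T Rgas.
  have ceta := C1_onB (C1_onB (C1_onM cC clnth) (C1_onM cRg clnr)) (C1_onM cb (C1_onX2 cq)).
  do 4 eexists; split.
  + exact: (C1_onM cr ceta).
  + exact: (C1_onD (C1_onM cu (C1_onM cr ceta)) (C1_onM cq cinv)).
  + move=> t x tT; have [e1 e2 e4 e5] := eqs t x tT.
    have [_ _ e3 _ _] := NS t x tT.
    rewrite (C1_on_dt x cE tT) (C1_on_dx x cH tT) in e3.
    have tT0 : 0 <= t < T by case/andP: tT => /ltW -> ->.
    have thp := th_gt0 x tT0; have [aE bE _ _] := ZP _ thp.
    have th0 := lt0r_neq0 thp; have r0 := lt0r_neq0 (r_gt0 x tT0).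
    have k0 := lt0r_neq0 (kappa_gt0 thp); have mu0 := lt0r_neq0 mu_gt0.
    rewrite -(@entropy_production R (r t x) (rt t x) (rx t x) (u t x) (ut t x) (ux t x)
      (th t x) (tht t x) (thx t x) (q t x) (qt t x) (qx t x) (S t x) (St t x) (Sx t x)
      (tau1 (th t x)) (kappa (th t x)) (Z1 (th t x)) (Z2 (th t x)) tau2 mu Cv Rgas
      (ln (r t x)) (ln (th t x)))//.
    * rewrite bE /r /u /th /q /S /db /Z /Zfun; field.
      by rewrite th0 k0 r0.
    * rewrite -[RHS]e3 aE /r /u /th /q /S /da /Z /Zfun; field.
      by rewrite th0 k0 mu0.
- have ct2 := C1_on_cst T tau2; have cx := C1_on_space T; have cmu := C1_on_cst T mu.
  have cRg := C1_on_cst T Rgas.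
  do 4 eexists; split.
  + exact: (C1_onB (C1_onM (C1_onM cr cu) cx) (C1_onM ct2 (C1_onM cr cS))).
  + exact: (C1_onD (C1_onB
      (C1_onM cx (C1_onB (C1_onB (C1_onD (C1_onM cu (C1_onM cr cu)) cp) cRg) cS))
      (C1_onM ct2 (C1_onM cu (C1_onM cr cS)))) (C1_onM cmu cu)).
  + move=> t x tT; have [e1 e2 e4 e5] := eqs t x tT.
    (* The mass law is weighted by the coefficient of [r] in the density, the momentum law by [x],
       and the stress equation is subtracted. *)
    have lin (a b c : R) : a = 0 -> b = 0 -> c = 0 ->
       (u t x * x - tau2 * S t x) * a + x * b - c = 0.
      by move=> -> -> ->; rewrite !mulr0 !addr0 subr0.
    apply/eqP; rewrite -subr_eq0; apply/eqP.
    apply: etrans (lin _ _ _ e1 e2 e5).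
    by rewrite /pressure /= /r /u /th /q /S; ring.
Qed.

End NavierStokes.

(** * Blow-up *)

Section Riccati.
Context {R : realType}.
Implicit Types (f df : R -> R) (c t T : R).

Lemma is_derive_ge0_le f df T : 0 <= T ->
  {within `[0, T], continuous f} ->
  (forall t, 0 < t < T -> is_derive t 1 f (df t)) ->
  (forall t, 0 < t < T -> 0 <= df t) ->
  forall t, 0 <= t <= T -> f 0 <= f t.
Proof.
move=> T0 cf dfE df0 t /andP[t0 tT].
apply: (@ger0_derive1_le_cc _ f 0 T) => //.
- by move=> x; rewrite in_itv/= => xT; have [] := dfE x xT.
- by move=> x; rewrite in_itv/= => xT; rewrite (is_derive1E (dfE x xT)); exact: df0.
- by rewrite in_itv/= lexx.
- by rewrite in_itv/= t0.
Qed.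

(** [- (f t)^-1 - c * t] is nondecreasing, and comparing its values at 0 and [T] gives the bound.
    The quadratic inequality is asked only where [f 0 <= f t], which the sign of [df] supplies
    beforehand. *)
Lemma riccati_time f df c T : 0 < T ->
  {within `[0, T], continuous f} ->
  (forall t, 0 < t < T -> is_derive t 1 f (df t)) ->
  (forall t, 0 < t < T -> 0 <= df t) ->
  (forall t, 0 < t < T -> f 0 <= f t -> c * f t ^+ 2 <= df t) ->
  0 < f 0 -> c * T * f 0 < 1.
Proof.
move=> T0 cf dfE df0 ric f0.
have fge t : 0 <= t <= T -> f 0 <= f t by exact: is_derive_ge0_le (ltW T0) cf dfE df0 t.
have fgt0 t : 0 <= t <= T -> 0 < f t by move=> tT; exact: lt_le_trans f0 (fge t tT).
pose g t := - (f t)^-1 - c * t.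
pose dg t := f t ^- 2 * df t - c.
have cg : {within `[0, T], continuous g}.
  have /subspace_continuousP cf' := cf; apply/subspace_continuousP => t tT.
  have tT' : 0 <= t <= T by move: tT; rewrite /= in_itv.
  apply: cvgB.
    by apply: cvgN; apply: cvgV; [rewrite gt_eqF// fgt0|exact: cf'].
  by apply: cvgM; [exact: cvg_cst|exact: cvg_within].
have gE t : 0 < t < T -> is_derive t 1 g (dg t).
  move=> tT; have ft : f t != 0.
    by rewrite gt_eqF// fgt0//; case/andP: tT => /ltW -> /ltW ->.
  apply: is_derive_eq (is_derive_sub (is_derive_opp (is_derive_inv ft (dfE t tT)))
    (is_derive_scale c (is_derive_id t 1))) _.
  by rewrite /dg mulr1 mulNr opprK.
have dg0 t : 0 < t < T -> 0 <= dg t.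
  move=> tT; have tT' : 0 <= t <= T by case/andP: tT => /ltW -> /ltW ->.
  rewrite /dg subr_ge0 mulrC ler_pdivlMr ?exprn_gt0 ?fgt0//.
  by apply: ric => //; exact: fge.
have TT : 0 <= T <= T by rewrite ltW/=.
have := is_derive_ge0_le (ltW T0) cg gE dg0 TT.
rewrite /g mulr0 subr0 => h.
have fT := fgt0 _ TT.
have fTV : 0 < (f T)^-1 by rewrite invr_gt0.
have : c * T < (f 0)^-1 by lra.
by rewrite -(ltr_pM2r f0) mulVf ?gt_eqF.
Qed.

End Riccati.

Section Blowup.
Context {R : realType}.
Implicit Types (f g : R -> R) (L c x : R).
Local Notation mu_ := (@lebesgue_measure R).
Local Notation rint L f := (\int[mu_]_(x in `[- L, L]) f x).

Lemma cont_funD f g : continuous f -> continuous g -> continuous (fun x => f x + g x).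
Proof. by move=> cf cg x; exact: contD (cf x) (cg x). Qed.

Lemma cont_funM f g : continuous f -> continuous g -> continuous (fun x => f x * g x).
Proof. by move=> cf cg x; exact: contM (cf x) (cg x). Qed.

Lemma cont_funZ c f : continuous f -> continuous (fun x => c * f x).
Proof. by move=> cf; exact: cont_funM (@cont_cst R c) cf. Qed.

Lemma rintD L f g : continuous f -> continuous g ->
  rint L (fun x => f x + g x) = rint L f + rint L g.
Proof. by move=> cf cg; apply: RintegralD => //; exact: continuous_integrable_seg. Qed.

Lemma rintZ L c f : continuous f -> rint L (fun x => c * f x) = c * rint L f.
Proof. by move=> cf; apply: RintegralZl => //; exact: continuous_integrable_seg. Qed.

Lemma rint_cst L c : 0 <= L -> rint L (fun=> c) = c * (2 * L).
Proof.
move=> L0; have mL : fine (mu_ `[- L, L]) = 2 * L.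
  rewrite lebesgue_measure_itv/= lte_fin; case: ifPn => [_|].
    by rewrite -EFinB/= opprK mulrDl mul1r.
  by rewrite -leNgt => L1 /=; lra.
by rewrite Rintegral_cst// mL.
Qed.

Lemma rint_le L f g : continuous f -> continuous g ->
  (forall x, - L <= x <= L -> f x <= g x) -> rint L f <= rint L g.
Proof.
by move=> cf cg fg; apply: le_Rintegral => //; exact: continuous_integrable_seg.
Qed.

(** Cauchy-Schwarz for the measure with density [w], whose second moment on [[- L, L]] is at most
    [L ^+ 2] times the mass [2 * L]. *)
Lemma weighted_virial_ge L (w v : R -> R) : 0 < L -> continuous w -> continuous v ->
  (forall x, 0 <= w x) -> rint L w = 2 * L ->
  0 < rint L (fun x => w x * v x * x) ->
  rint L (fun x => w x * v x * x) ^+ 2 / (2 * L ^+ 3) <= rint L (fun x => w x * v x ^+ 2).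
Proof.
move=> L0 cw cv w0 wL; set Y := rint L (fun x => w x * v x * x) => Y0.
set A := rint L _.
have cwv : continuous (fun x => w x * v x ^+ 2).
  exact: cont_funM cw (cont_funM cv cv).
have cY : continuous (fun x => w x * v x * x).
  exact: cont_funM (cont_funM cw cv) (@cont_id R).
pose l := 2 * L ^+ 3 / Y.
have l0 : 0 < l by rewrite divr_gt0 ?mulr_gt0 ?exprn_gt0.
(* AM-GM: [2 w v x <= l w v^2 + w x^2 / l], with [l] optimal *)
have : rint L (fun x => 2 * (w x * v x * x)) <=
    rint L (fun x => l * (w x * v x ^+ 2) + L ^+ 2 / l * w x).
  apply: rint_le.
  - exact: cont_funZ.
  - by apply: cont_funD; exact: cont_funZ.
  - move=> x xL.
    have x2 : x ^+ 2 <= L ^+ 2 by nra.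
    have h : 0 <= l * (v x - x / l) ^+ 2 by rewrite mulr_ge0 ?sqr_ge0// ltW.
    have e : l * (v x - x / l) ^+ 2 = l * v x ^+ 2 - 2 * v x * x + x ^+ 2 / l.
      by field; rewrite gt_eqF.
    have x2l : x ^+ 2 / l <= L ^+ 2 / l by rewrite ler_pM2r ?invr_gt0.
    have : 2 * (v x * x) <= l * v x ^+ 2 + L ^+ 2 / l by lra.
    move=> /(ler_wpM2l (w0 x)); lra.
rewrite rintZ// rintD ?rintZ//; first last.
- exact: cont_funZ.
- exact: cont_funZ.
rewrite -/Y -/A wL => h.
rewrite ler_pdivrMr ?mulr_gt0 ?exprn_gt0//.
have e1 : L ^+ 2 / l * (2 * L) = Y.
  by rewrite /l; field; rewrite !gt_eqF.
rewrite e1 in h.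
have : Y <= 2 * L ^+ 3 / Y * A by rewrite -/l; lra.
rewrite mulrAC ler_pdivlMr// expr2 => h2; lra.
Qed.

End Blowup.

Ltac solve_cont := solve [repeat first
  [assumption | exact: cont_cst | apply: cont_funD | apply: cont_funZ]].

(** * Upper bound for the lifetime *)

Section Lifetime.
Context {R : realType}.
Local Notation mu_ := (@lebesgue_measure R).
Local Notation rint L f := (\int[mu_]_(x in `[- L, L]) f x).

Lemma is_derive0_const (f df : R -> R) (T : R) : 0 <= T ->
  {within `[0, T], continuous f} ->
  (forall t, 0 < t < T -> is_derive t 1 f (df t)) ->
  (forall t, 0 < t < T -> df t = 0) ->
  forall t, 0 <= t <= T -> f t = f 0.
Proof.
move=> T0 cf dfE df0 t tT; apply/eqP; rewrite eq_le; apply/andP; split; last first.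
  by apply: (is_derive_ge0_le T0 cf dfE) tT => z /df0 ->.
rewrite -lerN2; apply: (@is_derive_ge0_le _ (fun t => - f t) (fun t => - df t)) tT => //.
- by move=> z; apply: cvgN; exact: cf.
- by move=> z zT; apply: is_derive_opp; exact: dfE.
- by move=> z /df0 ->; rewrite oppr0.
Qed.

Lemma ln_leB1 (x : R) : 0 < x -> ln x <= x - 1.
Proof. by move=> x0; rewrite -ler_expR lnK// (le_trans _ (expR_ge1Dx _))// addrC subrK. Qed.

Lemma xlnx_ge (x : R) : 0 < x -> x - 1 <= x * ln x.
Proof.
move=> x0; have xi : 0 < x^-1 by rewrite invr_gt0.
have := ln_leB1 xi; rewrite lnV// => h.
have : x * (- ln x) <= x * (x^-1 - 1) by rewrite ler_pM2l.
by rewrite mulrBr mulfV ?gt_eqF//; lra.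
Qed.

(** [f] exceeds [X] by at most half of [V0], so [X] is at least half of [f]; squaring costs the
    factor 4 between [2 * L ^+ 3] and [8 * L ^+ 3]. *)
Lemma riccati_rate (L V0 f X A : R) : 0 < L -> 0 < V0 -> V0 <= f -> f <= X + V0 / 2 ->
  (0 < X -> X ^+ 2 / (2 * L ^+ 3) <= A) -> (8 * L ^+ 3)^-1 * f ^+ 2 <= A.
Proof.
move=> L0 V00 Vf fX XA; have X0 : f / 2 <= X by lra.
have f0 : 0 < f by lra.
have f2 : 0 < f / 2 by lra.
have X1 := lt_le_trans f2 X0.
apply: le_trans (XA X1).
have -> : (8 * L ^+ 3)^-1 * f ^+ 2 = (f / 2) ^+ 2 / (2 * L ^+ 3) by field; rewrite gt_eqF.
by rewrite ler_pM2r ?invr_gt0 ?mulr_gt0 ?exprn_gt0// ler_sqr// nnegrE ltW.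
Qed.

Context (tau2 mu Cv Rgas : R) (tau1 kappa : R -> R).
Context (tau2_gt0 : 0 < tau2) (mu_gt0 : 0 < mu) (Cv_gt0 : 0 < Cv) (Rgas_gt0 : 0 < Rgas).
Context (tau1_smooth : smooth_on_pos tau1) (kappa_smooth : smooth_on_pos kappa).
Context (kappa_gt0 : forall th : R, 0 < th -> 0 < kappa th).
Context (a_gt0 : forall th : R, 0 < th -> 0 < afun tau1 kappa th).
Context (dZ_ge0 : forall th : R, 0 < th -> 0 <= half_dZ_over tau1 kappa th).
Let P := Gas tau2 mu Cv Rgas tau1 kappa.

Definition moving_data (u0 : R -> R) : state R :=
  State (fun=> 1) u0 (fun=> 1) (fun=> 0) (fun=> 0).

(** [l] is a free weight in Young's inequality for the stress correction; the last hypothesis says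
    that the resulting bound on the correction is at most [V0 / 2]. The conclusion is the Riccati
    time at rate [(8 * L ^+ 3)^-1]. *)
Lemma lifetime_bound (s : nat) (T T' L l : R) (u0 : R -> R) (U : R -> state R) :
  (2 <= s)%N -> smooth_solution P s T (moving_data u0) U ->
  0 < T' < T -> 0 < L ->
  (forall t x, 0 < t < T' -> L <= `|x| ->
     [/\ density (U t) x = 1, velocity (U t) x = 0, temperature (U t) x = 1,
         heatflux (U t) x = 0 & stress (U t) x = 0]) ->
  let V0 := rint L (fun x => u0 x * x) in
  0 < V0 -> 0 < l ->
  l * mu * rint L (fun x => u0 x ^+ 2) + 2 * L * tau2 / l <= V0 ->
  T' * V0 < 8 * L ^+ 3.
Proof.
move=> s2 solU /[dup] T'T /andP[T'0 TT] L0 bnd V0 V00 l0 lV0.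
have L0' := ltW L0.
have [lm le ls lv] := NS_conservation_laws mu_gt0 tau1_smooth kappa_smooth kappa_gt0 s2 solU.
have [U0E [cr_ cu_ cth_ cq_ cS_] pos _] := solU.
have LL : L <= `|- L| by rewrite normrN ler_norm.
(* Both ends are in the rest state, so each of the four fluxes takes equal values there. *)
have bLN t : 0 < t < T' -> _ := fun tT => conj (bnd t L tT (ler_norm L)) (bnd t (- L) tT LL).
have tT0 t : 0 < t < T' -> 0 <= t < T by case/andP => /ltW -> /lt_trans->.
have [|cm dm] := conservation_lawP lm T'T L0'.
  by move=> t /bLN[[-> -> _ _ _] [-> -> _ _ _]].
have [|ce de] := conservation_lawP le T'T L0'.
  move=> t /bLN[[rL uL thL qL SL] [rN uN thN qN SN]].
  by rewrite /energy /pressure rL uL thL qL SL rN uN thN qN SN.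
have [|cs ds] := conservation_lawP ls T'T L0'.
  by move=> t /bLN[[_ uL _ qL _] [_ uN _ qN _]]; rewrite uL qL uN qN !mul0r.
have [|cv dv] := conservation_lawP lv T'T L0'.
  move=> t /bLN[[rL uL thL qL SL] [rN uN thN qN SN]].
  by rewrite /pressure rL uL thL SL rN uN thN SN /=; ring.
move: (ltW T'0) => T'0'.
have cslice (f : R -> R -> R) (c t : R) : cont_Hs s (fun x => f t x - c) -> continuous (f t).
  move=> [cf _] x; have := contD (cf x) (@cont_cst R c x).
  by have -> : (fun z => f t z - c + c) = f t by apply/funext => z; rewrite subrK.
set G2 := rint L (fun x => u0 x ^+ 2) in lV0 *.
have cu0 : continuous u0.
  have -> : u0 = velocity (U 0) by rewrite U0E.
  have T00 : 0 <= (0 : R) < T by rewrite lexx (lt_trans T'0).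
  by have [] := cu_.1.1 0 T00.
have bounds t : 0 < t < T' ->
  let A := rint L (fun x => density (U t) x * velocity (U t) x ^+ 2) in
  let X := rint L (fun x => density (U t) x * velocity (U t) x * x) in
  [/\ 0 <= A, rint L (fun x => density (U t) x * velocity (U t) x ^+ 2
        + pressure P (U t) x - Rgas) >= A,
      rint L (fun x => density (U t) x * velocity (U t) x * x
        - tau2 * (density (U t) x * stress (U t) x)) <= X + V0 / 2 &
      0 < X -> X ^+ 2 / (2 * L ^+ 3) <= A].
  move=> tT A X; have tT0' := tT0 t tT.
  have tTc : 0 <= t <= T' by case/andP: tT => /ltW -> /ltW ->.
  pose r := density (U t); pose v := velocity (U t); pose th := temperature (U t).
  pose S := stress (U t).
  have cr : continuous r := cslice (fun t => density (U t)) 1 t (cr_.1.1 t tT0').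
  have cth : continuous th := cslice (fun t => temperature (U t)) 1 t (cth_.1.1 t tT0').
  have cvv : continuous v by have [] := cu_.1.1 t tT0'.
  have cS : continuous S by have [] := cS_.1.1 t tT0'.
  have r0 x : 0 < r x := (pos t x tT0').1.
  have th0 x : 0 < th x := (pos t x tT0').2.
  have crth := cont_funM cr cth.
  have crS2 : continuous (fun x => r x * S x ^+ 2) := cont_funM cr (cont_funM cS cS).
  have crS := cont_funM cr cS.
  have crv2 : continuous (fun x => r x * v x ^+ 2) := cont_funM cr (cont_funM cvv cvv).
  have crvx := cont_funM (cont_funM cr cvv) (@cont_id R).
  have z0 z : 0 < z < T' -> rint L (fun=> 0) = 0 by rewrite rint_cst// mul0r.
  have rL : rint L r = 2 * L.
    rewrite (is_derive0_const T'0' cm dm z0 tTc : rint L r = rint L (density (U 0))).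
    by rewrite U0E rint_cst// mul1r.
  pose B := rint L (fun x => r x * th x); pose C := rint L (fun x => r x * S x ^+ 2).
  have EL : rint L (energy P (U t)) = 2^-1 * G2 + Cv * (2 * L).
    rewrite (is_derive0_const T'0' ce de z0 tTc :
      rint L (energy P (U t)) = rint L (energy P (U 0))).
    rewrite U0E -rint_cst// -rintZ; last exact: (cont_funM cu0 cu0).
    rewrite -rintD; last exact: cont_cst.
      by apply: eq_Rintegral => x _; rewrite /energy /=; ring.
    by apply: cont_funZ; exact: (cont_funM cu0 cu0).
  have [gE [gE' [? [? [cE _ _]]]]] := le; have [cEt _ _] := C1_on_slice cE tT0'.
  have [gs [gs' [? [? [cs_ _ _]]]]] := ls; have [cst _ _] := C1_on_slice cs_ tT0'.
  (* The initial entropy is 0 and its production is nonnegative. *)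
  have sL : 0 <= rint L (fun x => r x * specific_entropy Cv Rgas tau1 kappa (U t) x).
    have ds0 z : 0 < z < T' -> 0 <= rint L (fun x =>
        stress (U z) x ^+ 2 / (mu * temperature (U z) x)
        + heatflux (U z) x ^+ 2 / (kappa (temperature (U z) x) * temperature (U z) x ^+ 2)).
      move=> zT; apply: Rintegral_ge0 => x _.
      have [_ thz] := pos z x (tT0 z zT).
      apply: addr_ge0; apply: divr_ge0; rewrite ?sqr_ge0// mulr_ge0 ?ltW//.
        exact: kappa_gt0.
      by rewrite exprn_gt0.
    apply: le_trans (is_derive_ge0_le T'0' cs ds ds0 tTc).
    rewrite U0E [leRHS](_ : _ = rint L (fun=> 0)); first by rewrite rint_cst// mul0r.
    apply: eq_Rintegral => x _.
    by rewrite /specific_entropy /= ln1 !mulr0 expr0n mulr0 !subr0 mulr0.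
  (* [ln th <= th - 1] and [r - 1 <= r * ln r] bound the entropy density by an affine expression in
     [r * th] and [r]; mass conservation reduces its integral to [Cv * (B - 2 * L)]. *)
  have BL : 2 * L <= B.
    have : rint L (fun x => r x * specific_entropy Cv Rgas tau1 kappa (U t) x) <=
        rint L (fun x => (Cv * (r x * th x) + (- (Cv + Rgas)) * r x) + Rgas).
      apply: rint_le => // [|x _].
        apply: cont_funD; last exact: cont_cst.
        by apply: cont_funD; exact: cont_funZ.
      have h1 := ler_wpM2l (ltW (mulr_gt0 Cv_gt0 (r0 x))) (ln_leB1 (th0 x)).
      have h2 := ler_wpM2l (ltW Rgas_gt0) (xlnx_ge (r0 x)).
      have h3 : 0 <= r x * (half_dZ_over tau1 kappa (th x) * heatflux (U t) x ^+ 2).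
        by rewrite mulr_ge0 ?(ltW (r0 x))// mulr_ge0 ?sqr_ge0// dZ_ge0.
      rewrite /specific_entropy -/(th x) -/(r x); lra.
    rewrite !rintD ?rintZ ?rint_cst//; try solve_cont.
    rewrite rL -/B => h.
    have : 0 <= Cv * (B - 2 * L) by lra.
    by rewrite pmulr_rge0// subr_ge0.
  (* Energy is conserved and its thermal part is at least [Cv * (2 * L)] by [BL], so only the
     initial kinetic energy is left for the stress. The kinetic and heat flux terms are dropped by
     sign. *)
  have CG : tau2 * C <= mu * G2.
    have : rint L (fun x => tau2 / (2 * mu) * (r x * S x ^+ 2) + Cv * (r x * th x)) <=
        rint L (energy P (U t)).
      apply: rint_le => // [|x _].
        by apply: cont_funD; exact: cont_funZ.
      have h1 : 0 <= r x * v x ^+ 2 by rewrite mulr_ge0 ?sqr_ge0// ltW.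
      have h2 : 0 <= r x * (afun tau1 kappa (th x) * heatflux (U t) x ^+ 2).
        by rewrite mulr_ge0 ?(ltW (r0 x))// mulr_ge0 ?sqr_ge0// ltW// a_gt0.
      rewrite /energy /= -/(th x) -/(r x) -/(v x) -/(S x); lra.
    rewrite rintD ?rintZ ?EL//; try solve_cont.
    rewrite -/B -/C => h.
    have h1 : Cv * (2 * L) <= Cv * B by rewrite ler_pM2l.
    have h2 : tau2 / (2 * mu) * C <= 2^-1 * G2 by lra.
    have m2 : 0 < 2 * mu by rewrite mulr_gt0.
    have := ler_wpM2l (ltW m2) h2.
    have -> : 2 * mu * (tau2 / (2 * mu) * C) = tau2 * C by field; rewrite gt_eqF.
    by have -> : 2 * mu * (2^-1 * G2) = mu * G2 by field.
  split.
  - by apply: Rintegral_ge0 => x _; rewrite mulr_ge0 ?sqr_ge0//; exact: (ltW (r0 x)).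
  - rewrite [leRHS](_ : _ = rint L (fun x => (r x * v x ^+ 2 + Rgas * (r x * th x)) + - Rgas)).
      rewrite !rintD ?rintZ ?rint_cst//; try solve_cont.
      rewrite -/A -/B; have : Rgas * (2 * L) <= Rgas * B by rewrite ler_pM2l.
      lra.
    by apply: eq_Rintegral => x _; rewrite /pressure /= mulrA.
  - rewrite [leLHS](_ : _ = rint L (fun x => r x * v x * x + (- tau2) * (r x * S x))).
      rewrite rintD ?rintZ//; try solve_cont.
      rewrite -/X; set D := rint L (fun x => r x * S x).
      (* Young's inequality with weight [l]: [CG] controls the first term, the mass the second. *)
      have : rint L (fun x => (- 2) * (r x * S x)) <=
          rint L (fun x => l * (r x * S x ^+ 2) + l^-1 * r x).
        apply: rint_le => [| |x _].
        + exact: cont_funZ.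
        + by apply: cont_funD; exact: cont_funZ.
        have h : 0 <= l * r x * (S x + l^-1) ^+ 2.
          by rewrite mulr_ge0 ?sqr_ge0// ltW// mulr_gt0.
        have e : l * r x * (S x + l^-1) ^+ 2 = l * (r x * S x ^+ 2) + 2 * (r x * S x) + l^-1 * r x.
          by field; rewrite gt_eqF.
        lra.
      rewrite rintD ?rintZ//; try solve_cont.
      rewrite rL -/C -/D => h.
      have := ler_wpM2l (ltW tau2_gt0) h.
      have := ler_wpM2l (ltW l0) CG.
      lra.
    by apply: eq_Rintegral => x _; rewrite mulNr.
  - by move=> X0; apply: (weighted_virial_ge L0 cr cvv) => // x; exact: ltW.
have f0 : rint L (fun x => density (U 0) x * velocity (U 0) x * x
        - tau2 * (density (U 0) x * stress (U 0) x)) = V0.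
  by apply: eq_Rintegral => x _; rewrite U0E /= mul1r !mulr0 subr0.
have L3 : 0 < 8 * L ^+ 3 by rewrite mulr_gt0 ?exprn_gt0.
have := riccati_time (c := (8 * L ^+ 3)^-1) T'0 cv dv; rewrite f0 => ric.
suff : (8 * L ^+ 3)^-1 * T' * V0 < 1 by rewrite -mulrA ltr_pdivrMl// mulr1.
apply: ric => //.
- by move=> t /bounds[A0 /(le_trans A0)].
- move=> t /bounds[_ A1 A2 A3] Vf; apply: le_trans A1.
  exact: (riccati_rate L0 V00 Vf A2 A3).
Qed.

End Lifetime.

(** * The initial data *)

Section TestFunctionsInHs.
Context {R : realType}.
Implicit Types (f g phi : R -> R) (a b c x : R) (k s : nat).
Local Notation mu_ := (@lebesgue_measure R).

Lemma test_zero : test_function (fun=> 0 : R).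
Proof.
split; first exact: smooth_cst.
by apply: (@tsupport_compact _ _ 0 0).
Qed.

Lemma Rintegral_by_parts_test f phi : test_function f -> test_function phi ->
  \int[mu_]_(x in [set: R]) (f x * derive1 phi x) =
  - \int[mu_]_(x in [set: R]) (derive1 f x * phi x).
Proof.
move=> tf tphi; have [K K0 KP] := test_bounded_support tphi.
(* The margin 1 makes [phi] vanish at the endpoints [L] and [- L] themselves, as the boundary terms
   require. *)
pose L := K + 1; have L0 : - L <= L by rewrite /L; lra.
have out k x : x \notin `[- L, L]%R -> derive1n k phi x = 0.
  move=> xL; apply: KP; apply: contra xL; rewrite !in_itv/= /L => /andP[? ?].
  by apply/andP; split; lra.
have outL x : (x == L) || (x == - L) -> phi x = 0.
  move=> xL; apply: (KP 0%N); rewrite in_itv/= negb_and -!ltNge /L.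
  by case/orP: xL => /eqP ->; apply/orP; [right|left]; rewrite /L; lra.
have sf := tf.1; have sphi := tphi.1.
have c1 : continuous (fun x => f x * derive1 phi x).
  exact: (cont_funM (smooth_continuous sf) (smooth_continuous (smooth_derive sphi))).
have c2 : continuous (fun x => phi x * derive1 f x).
  exact: (cont_funM (smooth_continuous sphi) (smooth_continuous (smooth_derive sf))).
rewrite !(Rintegral_support (a := - L) (b := L)); first last.
- by move=> x /(out 1%N) /= ->; rewrite mulr0.
- by move=> x /(out 0%N) /= ->; rewrite mulr0.
have := Rintegral_FTC L0 (cont_funD c1 c2)
  (fun x => is_derive_mul (smooth_derivable sf x) (smooth_derivable sphi x)).
rewrite !outL ?eqxx ?orbT// !mulr0 subr0 rintD// => /eqP; rewrite addr_eq0 => /eqP ->.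
by congr (- _); apply: eq_Rintegral => x _; rewrite mulrC.
Qed.

Lemma test_weak_derivative k f : test_function f -> is_weak_derivative k f (derive1n k f).
Proof.
move=> tf; split.
- by apply: continuous_locally_integrable; apply: smooth_continuous; exact: tf.1.
- by apply: continuous_locally_integrable; apply: smooth_continuous; exact: (test_derive1n k tf).1.
elim: k f tf => [|k IH] f tf phi tphi; first by rewrite expr0 mul1r.
rewrite /= (Rintegral_by_parts_test tf (test_derive1n k tphi)).
rewrite (IH (derive1 f) (test_derive1n 1 tf) phi tphi) exprS mulN1r mulNr.
by congr (- (_ * _)); apply: eq_Rintegral => x _; rewrite -derive1Sn.
Qed.

Lemma L2norm_support f a b : continuous f -> (forall x, x \notin `[a, b]%R -> f x = 0) ->
  L2norm f = ((\int[mu_]_(x in `[a, b]) f x ^+ 2) `^ 2^-1)%:E.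
Proof.
move=> cf f0; rewrite /L2norm unlock -poweR_EFin; congr (_ `^ _)%E.
have ci : mu_.-integrable `[a, b] (EFin \o (fun x => f x ^+ 2)).
  by apply: continuous_integrable_seg; exact: (cont_funM cf cf).
rewrite /Rintegral fineK; last exact: integrable_fin_num.
rewrite [RHS]integral_mkcond; apply: eq_integral => x _.
rewrite patchE /= -[2%R]/(2%:R) powR_mulrn// real_normK ?num_real//.
case: ifPn => // xab; rewrite f0 ?expr0n//.
by apply: contra xab => xab; rewrite inE.
Qed.

Lemma test_cont_Hs s f : test_function f -> cont_Hs s f.
Proof.
move=> tf; split; first by apply: smooth_continuous; exact: tf.1.
move=> k _; exists (derive1n k f); split; first exact: test_weak_derivative.
have [K K0 KP] := test_bounded_support tf.
rewrite (L2norm_support (a := - K) (b := K)) ?ltry//.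
- by apply: smooth_continuous; exact: (test_derive1n k tf).1.
- by move=> x; exact: KP.
Qed.

Lemma rint_ge_sub L f a b c : continuous f -> (forall x, 0 <= f x) ->
  - L <= a -> a <= b -> b <= L -> (forall x, a <= x <= b -> c <= f x) ->
  c * (b - a) <= \int[mu_]_(x in `[- L, L]) f x.
Proof.
move=> cf f0 La ab bL fc.
have cab : \int[mu_]_(x in `[a, b]) c = c * (b - a).
  have dcx x : is_derive x 1 (fun x => c * x) c.
    by apply: is_derive_eq (is_derive_scale c (is_derive_id x 1)) _; rewrite mulr1.
  by rewrite (Rintegral_FTC ab (@cont_cst R c) dcx) mulrBr.
have i1 := continuous_integrable_seg a b cf.
have i2 := continuous_integrable_seg (- L) L cf.
apply: (@le_trans _ _ (\int[mu_]_(x in `[a, b]) f x)).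
  rewrite -cab; apply: le_Rintegral => //.
  by apply: continuous_integrable_seg; exact: cont_cst.
apply: fine_le; [exact: integrable_fin_num|exact: integrable_fin_num|].
apply: ge0_subset_integral => //.
- by case/integrableP: i2.
- by move=> x _; rewrite lee_fin.
- move=> x /=; rewrite !in_itv/= => /andP[ax xb].
  by rewrite (le_trans La ax) (le_trans xb bL).
Qed.

End TestFunctionsInHs.

(** * A bump profile for the velocity and its moments *)

Section Bump.
Context {R : realType}.
Implicit Types (x y M c : R).
Local Notation mu_ := (@lebesgue_measure R).

(** The support lies on the right half line, which makes the first moment positive, and ends at 1/2,
    which keeps the closed support inside an open interval after scaling by [M]. *)
Definition bump x : R := flat 0 x * flat 0 (2^-1 - x).

Lemma smooth_bump : smooth bump.
Proof.
apply: smoothM; first exact: smooth_flat.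
rewrite (_ : (fun x => _) = fun x => flat 0 (-1 * x + 2^-1)); last first.
  by apply/funext => x; rewrite mulN1r addrC.
by apply: smooth_affine; exact: smooth_flat.
Qed.

Lemma bump_ge0 x : 0 <= bump x.
Proof. by rewrite mulr_ge0 ?flat_ge0. Qed.

Lemma flat0_le1 x : flat 0 x <= 1.
Proof.
rewrite /flat; case: ifPn => // x0.
by rewrite expr0 mul1r expR_le1 oppr_le0 invr_ge0 ltW.
Qed.

Lemma bump_le1 x : bump x <= 1.
Proof. by rewrite mulr_ile1 ?flat_ge0 ?flat0_le1. Qed.

Lemma bump_out x : x \notin `[0, 2^-1]%R -> bump x = 0.
Proof.
rewrite in_itv/= negb_and -!ltNge /bump => /orP[x0|x1].
  by rewrite flat_le0 ?mul0r// ltW.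
by rewrite [flat 0 (_ - _)]flat_le0 ?mulr0// subr_le0 ltW.
Qed.

(** A lower bound of [bump] on [[8^-1, 3 / 8]], where [x] and [2^-1 - x] are both at least
    [8^-1]. *)
Definition bump_min : R := flat 0 8^-1 ^+ 2.

Lemma bump_min_gt0 : 0 < bump_min.
Proof. by rewrite exprn_gt0// flat0_gt0// invr_gt0. Qed.

Lemma bump_min_le1 : bump_min <= 1.
Proof. by rewrite expr_le1 ?flat_ge0 ?flat0_le1. Qed.

Lemma bump_ge_min x : 8^-1 <= x <= 3 / 8 -> bump_min <= bump x.
Proof.
move=> /andP[x1 x2]; rewrite /bump_min expr2 ler_pM ?flat_ge0//; apply: flat0_homo => //.
by lra.
Qed.

(** The summand 0 gives the argument the shape that [smooth_affine] expects. *)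
Definition bump_velocity c M x : R := c * bump (M^-1 * x + 0).

Lemma bump_velocity_out c M x : 0 < M -> x \notin `[0, M / 2]%R -> bump_velocity c M x = 0.
Proof.
move=> M0 xM; rewrite /bump_velocity bump_out ?mulr0//.
apply: contra xM; rewrite !in_itv/= addr0 mulrC.
by rewrite pmulr_lge0 ?invr_gt0// ler_pdivrMr// [2^-1 * M]mulrC.
Qed.

Lemma test_bump_velocity c M : 0 < M -> test_function (bump_velocity c M).
Proof.
move=> M0; split.
  apply: smoothM; first exact: smooth_cst.
  by apply: smooth_affine; exact: smooth_bump.
by apply: (@tsupport_compact _ _ 0 (M / 2)) => x; exact: bump_velocity_out.
Qed.

Lemma bump_velocity_ge c M x : 0 < M -> 0 <= c -> M / 8 <= x <= M * 3 / 8 ->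
  c * bump_min <= bump_velocity c M x.
Proof.
move=> M0 c0 /andP[x1 x2]; rewrite ler_wpM2l// bump_ge_min// addr0 mulrC.
by rewrite ler_pdivlMr// ler_pdivrMr//; apply/andP; split; lra.
Qed.

End Bump.

Section BumpMoments.
Context {R : realType}.
Implicit Types (x M c : R).
Local Notation mu_ := (@lebesgue_measure R).
Local Notation rint L f := (\int[mu_]_(x in `[- L, L]) f x).

Lemma continuous_bump_velocity c M : 0 < M -> continuous (bump_velocity c M).
Proof. by move=> M0; apply: smooth_continuous; exact: (test_bump_velocity c M0).1. Qed.

Lemma bump_velocity_out2 c M x : 0 < M -> x \notin `[- (2 * M), 2 * M]%R ->
  bump_velocity c M x = 0.
Proof.
move=> M0 xM; apply: bump_velocity_out => //; apply: contra xM.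
by rewrite !in_itv/= => /andP[? ?]; apply/andP; split; lra.
Qed.

(** Only the interval from [M / 8] to [M * 3 / 8] is kept: there [x] is at least [M / 8], and the
    length is [M / 4], whence the 32. *)
Lemma bump_moment_ge c M : 0 < M -> 0 <= c ->
  c * bump_min * M ^+ 2 / 32 <= rint (2 * M) (fun x => bump_velocity c M x * x).
Proof.
move=> M0 c0; have m0 := @bump_min_gt0 R.
have -> : c * bump_min * M ^+ 2 / 32 = c * bump_min * (M / 8) * (M * 3 / 8 - M / 8).
  by field.
have cf : continuous (fun x => bump_velocity c M x * x).
  exact: (cont_funM (@continuous_bump_velocity c M M0) (@cont_id R)).
apply: (rint_ge_sub cf); [move=> x|lra|lra|lra|move=> x xM].
- have [x0|x0] := leP 0 x; first by rewrite mulr_ge0// mulr_ge0// bump_ge0.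
  by rewrite bump_velocity_out ?mul0r// in_itv/= leNgt x0.
- by apply: ler_pM; [rewrite mulr_ge0// ltW|lra|exact: bump_velocity_ge|case/andP: xM].
Qed.

Lemma bump_square_le c M : 0 < M ->
  rint (2 * M) (fun x => bump_velocity c M x ^+ 2) <= 4 * c ^+ 2 * M.
Proof.
move=> M0; have -> : 4 * c ^+ 2 * M = c ^+ 2 * (2 * (2 * M)) by ring.
rewrite -rint_cst; last lra.
have cu := @continuous_bump_velocity c M M0.
apply: rint_le => [| |x _]; [exact: (cont_funM cu cu)|exact: cont_cst|].
rewrite exprMn ler_piMr ?sqr_ge0// expr_le1 ?bump_ge0 ?bump_le1//.
Qed.

Lemma bump_square_gt0 c M : 0 < M -> 0 < c ->
  0 < rint (2 * M) (fun x => bump_velocity c M x ^+ 2).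
Proof.
move=> M0 c0; have m0 := @bump_min_gt0 R.
have cu := @continuous_bump_velocity c M M0.
apply: (@lt_le_trans _ _ ((c * bump_min) ^+ 2 * (M * 3 / 8 - M / 8))).
  have M8 : 0 < M * 3 / 8 - M / 8 by lra.
  by rewrite mulr_gt0// exprn_gt0// mulr_gt0.
have cf : continuous (fun x => bump_velocity c M x ^+ 2) := cont_funM cu cu.
apply: (rint_ge_sub cf); [move=> x|lra|lra|lra|move=> x xM].
- exact: sqr_ge0.
- have h := bump_velocity_ge M0 (ltW c0) xM.
  have h0 : 0 <= c * bump_min by rewrite mulr_ge0// ltW.
  by rewrite ler_sqr// nnegrE// (le_trans h0).
Qed.

End BumpMoments.

(** * Admissibility and functionals of the initial state *)

Section MovingData.
Context {R : realType} (P : gas R).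
Implicit Types (M L : R) (s : nat).
Local Notation mu_ := (@lebesgue_measure R).
Local Notation rint L f := (\int[mu_]_(x in `[- L, L]) f x).

Lemma moving_data_Hs s (u0 : R -> R) : test_function u0 -> Hs_data s (moving_data u0).
Proof.
move=> tu; have z1 : cont_Hs s (fun=> (1 - 1 : R)).
  by rewrite subrr; apply: test_cont_Hs; exact: test_zero.
have z0 : cont_Hs s (fun=> (0 : R)) by apply: test_cont_Hs; exact: test_zero.
by split => //; exact: test_cont_Hs.
Qed.

Lemma range_cst (c : R) : range (fun _ : R => c) = [set c].
Proof. by apply/seteqP; split=> [_ [x _ <-]//|_ ->]; exists 0. Qed.

Lemma moving_data_positive (u0 : R -> R) : positive_data (moving_data u0).
Proof. by rewrite /positive_data /= minxx range_cst inf1 ltr01. Qed.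

Lemma moving_data_max (u0 : R -> R) : max_density (moving_data u0) = 1.
Proof. by rewrite /max_density /= range_cst sup1. Qed.

Lemma moving_data_supported M (u0 : R -> R) : 0 < M ->
  (forall x, x \notin `[0, M / 2]%R -> u0 x = 0) -> supported_in M (moving_data u0).
Proof.
move=> M0 u00.
have z (f : R -> R) : (forall x, f x = 0) -> tsupport f `<=` [set x | - M < x < M].
  move=> f0 x /(@tsupport_sub _ f 0 0 (fun x _ => f0 x)).
  by rewrite /= in_itv/= => /andP[? ?]; apply/andP; split; lra.
split; try by apply: z => x; rewrite /= ?subrr.
move=> x /(tsupport_sub u00); rewrite /= in_itv/= => /andP[? ?].
by apply/andP; split; lra.
Qed.

Context (L : R) (u0 : R -> R) (u0_cont : continuous u0)
  (u0_out : forall x, x \notin `[- L, L]%R -> u0 x = 0).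

Lemma moving_data_F : Ffun P (moving_data u0) = rint L (fun x => u0 x * x).
Proof.
rewrite /Ffun /= [X in _ - _ * X](_ : _ = 0); last first.
  (* The integrand vanishes everywhere, so the empty interval [[1, 0]] may serve as its support. *)
  rewrite (Rintegral_support (a := 1) (b := 0)); last by move=> *; rewrite mulr0.
  by rewrite set_itv_ge ?bnd_simp ?ltr01 -?ltNge ?ltr01// Rintegral_set0.
rewrite mulr0 subr0 (Rintegral_support (a := - L) (b := L)).
  by apply: eq_Rintegral => x _; rewrite mul1r.
by move=> x /u0_out ->; rewrite mulr0 mul0r.
Qed.

Lemma moving_data_G : Gfun P (moving_data u0) = 2^-1 * rint L (fun x => u0 x ^+ 2).
Proof.
rewrite -rintZ; last exact: (cont_funM u0_cont u0_cont).
rewrite /Gfun (Rintegral_support (a := - L) (b := L)).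
  by apply: eq_Rintegral => x _; rewrite /energy /=; ring.
by move=> x /u0_out u0x; rewrite /energy /= u0x; ring.
Qed.

Lemma moving_data_H : Hfun P (moving_data u0) = 0.
Proof.
rewrite /Hfun (Rintegral_support (a := 1) (b := 0)).
  by rewrite set_itv_ge ?bnd_simp -?ltNge ?ltr01// Rintegral_set0.
by move=> x _; rewrite /= ln1; ring.
Qed.

Lemma moving_data_L2 : fine (L2norm (velocity (moving_data u0))) ^+ 2 =
  rint L (fun x => u0 x ^+ 2).
Proof.
rewrite (L2norm_support u0_cont u0_out) /=.
have I0 : 0 <= rint L (fun x => u0 x ^+ 2) by apply: Rintegral_ge0 => x _; exact: sqr_ge0.
by rewrite powR12_sqrt// sqr_sqrtr.
Qed.

Lemma lifespan_fin (s : nat) (U0 : state R) (B : R) :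
  (forall (T : R) (U : R -> state R), 0 <= T -> smooth_solution P s T U0 U -> T <= B) ->
  lifespan P s U0 \is a fin_num.
Proof.
move=> TB.
(* The length 0 is always attained: on the empty time interval every condition but the initial one
   is vacuous. This rules out the value [-oo]. *)
have ge0 : (0 <= lifespan P s U0)%E.
  apply: ereal_sup_ubound; exists 0 => //; split => //; exists (fun=> U0).
  have vac (t : R) : 0 <= t < 0 -> False by case/andP => t0 /(le_lt_trans t0); rewrite ltxx.
  have C0v k (f : R -> R -> R) : C0_Hs k 0 f by split=> t /vac.
  have C1v k (f : R -> R -> R) : C1_Hs k 0 f.
    by split => //; exists f; split => // t /vac.
  split => //; first by move=> t x /vac.
  by move=> t x /andP[t0 /(lt_trans t0)]; rewrite ltxx.
rewrite ge0_fin_numE// (@le_lt_trans _ _ B%:E)// ?ltry//.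
apply: ge_ereal_sup => _ [T [T0 [U solU]] <-]; rewrite lee_fin.
exact: TB solU.
Qed.

End MovingData.

Theorem theorem4p2 (R : realType) (tau2 mu : R) (tau1 kappa : R -> R)
  (tau2_gt0 : 0 < tau2) (mu_gt0 : 0 < mu)
  (tau1_smooth : smooth_on_pos tau1) (kappa_smooth : smooth_on_pos kappa)
  (tau1_gt0 : forall th : R, 0 < th -> 0 < tau1 th)
  (kappa_gt0 : forall th : R, 0 < th -> 0 < kappa th)
  (a_gt0 : forall th : R, 0 < th -> 0 < afun tau1 kappa th)
  (da_ge0 : forall th : R, 0 < th -> 0 <= derive1 (afun tau1 kappa) th)
  (dZ_ge0 : forall th : R, 0 < th -> 0 <= half_dZ_over tau1 kappa th) :
  exists delta M0 : R, 0 < delta /\ 0 < M0 /\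
  forall (Cv Rgas : R), 0 < Cv -> 0 < Rgas ->
  let P := Gas tau2 mu Cv Rgas tau1 kappa in
  gamma P < 1 + delta ->
  forall (s : nat) (sigma M : R), (2 <= s)%N ->
  0 < sigma -> finite_propagation_speed P s sigma -> M0 <= M ->
  exists U0 : state R,
    [/\ Hs_data s U0, positive_data U0, supported_in M U0 & 0 < Gfun P U0] /\
    [/\ 32 * sigma * max_density U0 / (3 - gamma P) * M ^+ 2 < Ffun P U0,
        4 * ((3 - gamma P) * mu * tau2 / M ^+ 2 + gamma P - 1)
          * (Hfun P U0 + max_density U0 / 2 * fine (L2norm (velocity U0)) ^+ 2)
        <= 128 * sigma ^+ 2 * max_density U0 * M / (3 - gamma P) &
        lifespan P s U0 \is a fin_num].
Proof.
pose m := @bump_min R; have m0 : 0 < m := @bump_min_gt0 R.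
have m1 : m <= 1 := @bump_min_le1 R.
have k1 : m <= 64 * 32 by lra.
(* [A] makes [F(0) >= 64 sigma M^2], twice the required bound, and this is exactly
   what rules out a solution living longer than [M / sigma]. *)
pose A := 64 * 32 / m; have A0 : 0 < A by rewrite divr_gt0// (lt_le_trans m0).
have A1 : 1 <= A by rewrite ler_pdivlMr// mul1r.
have AA : 1 <= A ^+ 2 by rewrite exprn_ege1.
(* Both parts of the bracket in the second inequality, [gamma P - 1] and the relaxation term over
   [M ^+ 2], become of order [A ^- 2]. The summand 1 ensures [1 <= M], so that [M ^+ 2] inherits the
   lower bound on [M]. *)
exists (A ^- 2), (1 + A ^+ 2 * mu * tau2); split; first by rewrite invr_gt0 exprn_gt0.
have Amt : 0 < A ^+ 2 * mu * tau2 by rewrite mulr_gt0// mulr_gt0// exprn_gt0.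
split=> [|Cv Rgas Cv0 Rgas0 P]; first by lra.
rewrite /gamma /=; set g := Rgas / Cv => gd s sigma M s2 sg0 fps MM.
have g0 : 0 < g by rewrite divr_gt0.
have {}gd : g < A ^- 2 by lra.
have d1 : A ^- 2 <= 1 by rewrite invf_le1 ?exprn_gt0.
have M0 : 0 < M by lra.
have M2 : A ^+ 2 * mu * tau2 <= M ^+ 2 by nra.
have M20 : 0 < M ^+ 2 by rewrite exprn_gt0.
pose c := A * sigma; have c0 : 0 < c by rewrite mulr_gt0.
pose u0 := bump_velocity c M.
have tu := test_bump_velocity c M0.
have cu : continuous u0 := @continuous_bump_velocity R c M M0.
have out x : x \notin `[- (2 * M), 2 * M]%R -> u0 x = 0 := @bump_velocity_out2 _ c M x M0.
(* The factors 32 and [m] in [A] undo those of [bump_moment_ge]. *)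
have V64 : 64 * sigma * M ^+ 2 <= \int[lebesgue_measure]_(x in `[- (2 * M), 2 * M]) (u0 x * x).
  apply: le_trans (bump_moment_ge M0 (ltW c0)).
  by rewrite /c /A -/m le_eqVlt; apply/orP; left; apply/eqP; field; rewrite gt_eqF.
have G4 := bump_square_le c M0.
have G0 := bump_square_gt0 M0 c0.
have supp : supported_in M (moving_data u0).
  by apply: moving_data_supported => // x; exact: bump_velocity_out.
have hs := moving_data_Hs s tu.
have posd := moving_data_positive u0.
exists (moving_data u0); rewrite moving_data_max (moving_data_F _ out) (moving_data_G _ cu out)
  moving_data_H (moving_data_L2 cu out).
set V0 := (X in 64 * sigma * M ^+ 2 <= X) in V64; rewrite -/V0.
set G2 := (X in X <= 4 * c ^+ 2 * M) in G4; rewrite -/G2 in G0 *.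
have den : 1 <= 3 - (1 + g) by lra.
have den0 : 0 < 3 - (1 + g) by lra.
split; split => //.
- by rewrite mulr_gt0.
- apply: lt_le_trans V64; rewrite mulr1 ltr_pM2r// ltr_pdivrMr//.
  have : 64 * sigma * 1 <= 64 * sigma * (3 - (1 + g)) by rewrite ler_pM2l// mulr_gt0.
  have : 0 < sigma by [].
  lra.
- have e1 : (3 - (1 + g)) * mu * tau2 / M ^+ 2 <= 2 * A ^- 2.
    rewrite ler_pdivrMr//.
    have : 2 * A ^- 2 * (A ^+ 2 * mu * tau2) <= 2 * A ^- 2 * M ^+ 2.
      by rewrite ler_pM2l// mulr_gt0 ?invr_gt0 ?exprn_gt0.
    have -> : 2 * A ^- 2 * (A ^+ 2 * mu * tau2) = 2 * (mu * tau2) by field; rewrite gt_eqF.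
    apply: le_trans; rewrite -mulrA ler_pM2r ?mulr_gt0//; lra.
  have e2 : (3 - (1 + g)) * mu * tau2 / M ^+ 2 + (1 + g) - 1 <= 3 * A ^- 2 by lra.
  rewrite add0r mulr1 mul1r.
  have e3 : 64 * sigma ^+ 2 * M <= 128 * sigma ^+ 2 * M / (3 - (1 + g)).
    rewrite ler_pdivlMr//.
    have : 64 * sigma ^+ 2 * M * (3 - (1 + g)) <= 64 * sigma ^+ 2 * M * 2.
      by rewrite ler_pM2l ?mulr_gt0 ?exprn_gt0//; lra.
    lra.
  apply: le_trans e3.
  apply: (@le_trans _ _ (4 * (3 * A ^- 2) * (2^-1 * (4 * c ^+ 2 * M)))).
    apply: ler_pM.
    + rewrite mulr_ge0// -addrA addr_ge0//; last lra.
      by rewrite divr_ge0 ?(ltW M20)// !mulr_ge0 ?ltW.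
    + by rewrite mulr_ge0// ltW.
    + by rewrite ler_pM2l.
    + by rewrite ler_pM2l// invr_gt0.
  (* [A] cancels and leaves 24 against the 64 of [e3]. *)
  have -> : 4 * (3 * A ^- 2) * (2^-1 * (4 * c ^+ 2 * M)) = 24 * (sigma ^+ 2 * M).
    by rewrite /c; field; rewrite gt_eqF.
  have : 0 < sigma ^+ 2 * M by rewrite mulr_gt0 ?exprn_gt0.
  lra.
- apply: (lifespan_fin (B := M / sigma)) => T U T0 solU; rewrite leNgt; apply/negP => MT.
  have Ms : 0 < M / sigma by rewrite divr_gt0.
  have mA : 0 < mu * A ^+ 2 * sigma by rewrite mulr_gt0// mulr_gt0// exprn_gt0.
  have T00 : 0 < T by exact: lt_trans MT.
  (* The weight is chosen so that the first term of the smallness condition is at most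
     [32 * sigma * M ^+ 2], half of the lower bound for [V0]; the second is then at most
     [2^-1 * sigma * M ^+ 2] by the choice of [M0]. *)
  have := @lifetime_bound R tau2 mu Cv Rgas tau1 kappa tau2_gt0 mu_gt0 Cv0 Rgas0
    tau1_smooth kappa_smooth kappa_gt0 a_gt0 dZ_ge0 s T (M / sigma) (2 * M)
    (8 * M / (mu * A ^+ 2 * sigma)) u0 U s2 solU.
  rewrite Ms MT /= => /(_ isT) LB.
  (* By [V64] the left side is at least [8 * (2 * M) ^+ 3], so this strict inequality is a
     contradiction. *)
  suff : M / sigma * V0 < 8 * (2 * M) ^+ 3.
    have : M / sigma * (64 * sigma * M ^+ 2) <= M / sigma * V0 by rewrite ler_pM2l.
    have -> : M / sigma * (64 * sigma * M ^+ 2) = 8 * (2 * M) ^+ 3 by field; rewrite gt_eqF.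
    lra.
  apply: LB.
  + by rewrite mulr_gt0.
  + move=> t x /andP[t0 tM] xM.
    have [||rE uE thE qE SE] := fps _ M T U hs posd M0 supp T00 solU t x => //.
      by rewrite (ltW t0) (lt_trans tM).
    apply: le_trans xM.
    have : sigma * t <= M by rewrite mulrC -ler_pdivlMr// ltW.
    lra.
  + by apply: lt_le_trans V64; rewrite mulr_gt0// mulr_gt0.
  + by rewrite divr_gt0// mulr_gt0.
  + rewrite -/G2 -/V0; apply: le_trans V64.
    have h1 : 8 * M / (mu * A ^+ 2 * sigma) * mu * G2 <= 32 * sigma * M ^+ 2.
      apply: (@le_trans _ _ (8 * M / (mu * A ^+ 2 * sigma) * mu * (4 * c ^+ 2 * M))).
        by rewrite ler_pM2l// mulr_gt0// divr_gt0// mulr_gt0.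
      by rewrite le_eqVlt; apply/orP; left; apply/eqP; rewrite /c; field; rewrite !gt_eqF.
    have h2 : 2 * (2 * M) * tau2 / (8 * M / (mu * A ^+ 2 * sigma)) <= 32 * sigma * M ^+ 2.
      have -> : 2 * (2 * M) * tau2 / (8 * M / (mu * A ^+ 2 * sigma)) =
          2^-1 * sigma * (A ^+ 2 * mu * tau2) by field; rewrite !gt_eqF.
      have : 2^-1 * sigma * (A ^+ 2 * mu * tau2) <= 2^-1 * sigma * M ^+ 2.
        by rewrite ler_pM2l// mulr_gt0// invr_gt0.
      have : 0 < sigma * M ^+ 2 by rewrite mulr_gt0.
      lra.
    lra.
Qed.
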